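(* The partial trivialization $\{T_{M,L}:(M,L)\in U_2\}$, $T_{M,L}=\frac{(-1)^{d\cdot n}}{|M|^2}F_{M,L}^{\otimes4}$, extends in a unique manner to a trivialization of the $H(V)^4$-vector bundle $\mathfrak{H}^{\otimes4}$ on $ELag(V)$.
   Context: Let $K$ be an unramified extension of $\mathbb{Q}_2$ of degree $d$, $\mathcal{O}_K$ its ring of integers, $\mathfrak{m}_K=2\mathcal{O}_K$, $k=\mathcal{O}_K/\mathfrak{m}_K=\mathbb{F}_{2^d}$, $R=\mathcal{O}_K/\mathfrak{m}_K^2$, $tr:R\to\mathbb{Z}/4$ the trace, $\psi(z)=e^{\frac{2\pi i}{4}tr(z)}$ for $z\in R$. Let $(\widetilde{V},\widetilde{\omega})$ be a free symplectic $R$-module of rank $2n$, $V=\widetilde{V}/2\widetilde{V}$. The form $2\widetilde{\omega}$ factors to a non-degenerate skew-symmetric form $\omega:V\times V\to R$. Fix a splitting $\widetilde{V}=\widetilde{L}_0\times\widetilde{M}_0$ into free Lagrangian submodules; put $\widetilde{\beta}((l_1,m_1),(l_2,m_2))=\widetilde{\omega}(l_1,m_2)$; $2\widetilde{\beta}$ factors to $\beta:V\times V\to R$. The Heisenberg group is $H(V)=V\times R$ with $(v_1,z_1)(v_2,z_2)=(v_1+v_2,z_1+z_2+\beta(v_1,v_2))$, with center $Z=\{0\}\times R$. $ELag(V)$ is the set of enhanced Lagrangians: group homomorphisms $\tau:L\to H(V)$ that are sections of $H(V)\to V$ over a Lagrangian subspace $L\subset V$; such $\tau$ is denoted simply $L$.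 For $L\in ELag(V)$, $\mathcal{H}_L$ is the space of functions $f:H(V)\to\mathbb{C}$ with $f(z\cdot\tau(l)\cdot h)=\psi(z)f(h)$ for $z\in Z$, $l\in L$, $h\in H(V)$, with $H(V)$ acting by right translations. These form a bundle $\mathfrak{H}$ on $ELag(V)$ with fibers $\mathfrak{H}_L=\mathcal{H}_L$; $H(V)^4$ acts factorwise on the fibers $\mathcal{H}_L^{\otimes4}$ of $\mathfrak{H}^{\otimes4}$. An $H(V)^m$-vector bundle $\mathfrak{E}$ on $ELag(V)$ is a family of complex vector spaces $\mathfrak{E}_L$, $L\in ELag(V)$, each with an action of $H(V)^m$. A trivialization of $\mathfrak{E}$ is a system of intertwining isomorphisms $E_{M,L}\in\mathrm{Hom}_{H(V)^m}(\mathfrak{E}_L,\mathfrak{E}_M)$, for all $(M,L)\in ELag(V)^2$, with $E_{N,M}\circ E_{M,L}=E_{N,L}$ for all $N,M,L\in ELag(V)$. $U_2\subset ELag(V)^2$ is the set of pairs $(M,L)$ in general position, i.e. $M+L=V$. For $(M,L)\in U_2$, $F_{M,L}:\mathcal{H}_L\to\mathcal{H}_M$ is the intertwining morphism $F_{M,L}[f](h)=\sum_{m\in M}f(\tau(m)\cdot h)$, with $\tau:M\to H(V)$ the enhanced Lagrangian $M$. *)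

(* Defs.v *)
From HB Require Import structures.
From mathcomp Require Import all_boot all_order all_algebra all_field finmap.
From mathcomp Require Import boolp classical_sets functions cardinality fsbigop.
From mathcomp Require Import generic_quotient ring_quotient.
From mathcomp Require Import reals trigo.
From mathcomp Require Import complex.

Set Implicit Arguments.
Unset Strict Implicit.
Unset Printing Implicit Defensive.

Import Order.TTheory GRing.Theory Num.Theory.
Local Open Scope classical_set_scope.
Local Open Scope ring_scope.

Section TwoAdic.

Implicit Types n m : nat.

(* The 2-adic integers are the inverse limit of the rings Z / 2 ^ n.+1; the
   successor keeps 'Z_(_) away from the trivial ring, where it is not Z / 1. *)
Definition coherent (x : forall n, 'Z_(2 ^ n.+1)) : Prop :=
  forall n, x n = (x n.+1 : nat)%:R.

Lemma ltn_exp2S n : (1 < 2 ^ n.+1)%N.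
Proof. by rewrite -{1}(expn0 2) ltn_exp2l. Qed.

Lemma natZ2_mod n m : (m %% 2 ^ n.+2)%N%:R = m%:R :> 'Z_(2 ^ n.+1).
Proof.
rewrite [in RHS](divn_eq m (2 ^ n.+2)) natrD natrM (expnS 2 n.+1) natrM.
by rewrite [X in _ * (_ * X)]pchar_Zp ?ltn_exp2S // !mulr0 add0r.
Qed.

Lemma natZ2_trunc n m :
  (m %% (Zp_trunc (2 ^ n.+2)).+2)%N%:R = m%:R :> 'Z_(2 ^ n.+1).
Proof. by have /Zp_cast -> := ltn_exp2S n.+1; rewrite natZ2_mod. Qed.

Fact coherent0 : coherent (fun=> 0).
Proof. by []. Qed.

Fact coherent1 : coherent (fun=> 1).
Proof. by move=> n; rewrite -natZ2_trunc. Qed.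

Fact coherentD x y : coherent x -> coherent y -> coherent (fun n => x n + y n).
Proof. by move=> cx cy n; rewrite natZ2_trunc natrD -cx -cy. Qed.

Fact coherentN x : coherent x -> coherent (fun n => - x n).
Proof.
move=> cx n; apply/esym/eqP; rewrite -addr_eq0 addrC {1}(cx n) -natrD.
by rewrite -natZ2_trunc -[X in X%:R]/(nat_of_ord (x n.+1 + - x n.+1)) subrr.
Qed.

Fact coherentM x y : coherent x -> coherent y -> coherent (fun n => x n * y n).
Proof. by move=> cx cy n; rewrite natZ2_trunc natrM -cx -cy. Qed.

Definition Z2adic : Type := {x : forall n, 'Z_(2 ^ n.+1) | `[< coherent x >]}.
HB.instance Definition _ := Choice.on Z2adic.

Definition Z2mod n (x : Z2adic) : 'Z_(2 ^ n.+1) := val x n.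

Definition MkZ2 x (cx : coherent x) : Z2adic := exist _ x (asboolT cx).

Lemma coherentP (x : Z2adic) : coherent (fun n => Z2mod n x).
Proof. exact: (asboolW (valP x)). Qed.

Lemma Z2P (x y : Z2adic) : (forall n, Z2mod n x = Z2mod n y) -> x = y.
Proof. by move=> exy; apply: val_inj; apply: functional_extensionality_dep. Qed.

Let zero2 := MkZ2 coherent0.
Let one2 := MkZ2 coherent1.
Let opp2 x := MkZ2 (coherentN (coherentP x)).
Let add2 x y := MkZ2 (coherentD (coherentP x) (coherentP y)).
Let mul2 x y := MkZ2 (coherentM (coherentP x) (coherentP y)).

Fact add2A : associative add2.
Proof. by move=> x y z; apply: Z2P => n; apply: addrA. Qed.
Fact add2C : commutative add2.
Proof. by move=> x y; apply: Z2P => n; apply: addrC. Qed.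
Fact add20 : left_id zero2 add2.
Proof. by move=> x; apply: Z2P => n; apply: add0r. Qed.
Fact add2N : left_inverse zero2 opp2 add2.
Proof. by move=> x; apply: Z2P => n; apply: addNr. Qed.
Fact mul2A : associative mul2.
Proof. by move=> x y z; apply: Z2P => n; apply: mulrA. Qed.
Fact mul2C : commutative mul2.
Proof. by move=> x y; apply: Z2P => n; apply: mulrC. Qed.
Fact mul21 : left_id one2 mul2.
Proof. by move=> x; apply: Z2P => n; apply: mul1r. Qed.
Fact mul2D : left_distributive mul2 add2.
Proof. by move=> x y z; apply: Z2P => n; apply: mulrDl. Qed.
Fact one2_neq0 : one2 != zero2.
Proof. by apply/eqP => /(congr1 (Z2mod 0)). Qed.

HB.instance Definition _ := GRing.isZmodule.Build Z2adic add2A add2C add20 add2N.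
HB.instance Definition _ :=
  GRing.Zmodule_isComNzRing.Build Z2adic mul2A mul2C mul21 mul2D one2_neq0.

Fact Z2mod_zmod_morphism n : zmod_morphism (Z2mod n). Proof. by []. Qed.
Fact Z2mod_monoid_morphism n : monoid_morphism (Z2mod n). Proof. by []. Qed.
HB.instance Definition _ n :=
  GRing.isZmodMorphism.Build Z2adic _ (Z2mod n) (Z2mod_zmod_morphism n).
HB.instance Definition _ n :=
  GRing.isMonoidMorphism.Build Z2adic _ (Z2mod n) (Z2mod_monoid_morphism n).

Lemma Z2mod_le (x : Z2adic) n m : (n <= m)%N ->
  (Z2mod m x : nat) = Z2mod n x %[mod 2 ^ n.+1].
Proof.
elim: m => [|m IHm]; first by rewrite leqn0 => /eqP->.
rewrite leq_eqVlt ltnS => /predU1P[-> // | le_nm].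
rewrite -(IHm le_nm) (coherentP x m) val_Zp_nat ?ltn_exp2S //.
by rewrite modn_dvdm // dvdn_exp2l // ltnS.
Qed.

Lemma Z2_neq0 (x : Z2adic) : x != 0 ->
  exists n, forall m, (n <= m)%N -> ~~ (2 ^ n.+1 %| Z2mod m x)%N.
Proof.
move=> x0; have [n xn] : exists n, Z2mod n x != 0.
  apply/not_existsP => h; case/negP: x0; apply/eqP/Z2P => n.
  by have /negP := h n; rewrite negbK => /eqP.
exists n => m lenm; rewrite /dvdn (Z2mod_le x lenm).
rewrite modn_small //; last first.
  by rewrite -[X in (_ < X)%N]Zp_cast ?ltn_exp2S.
Qed.

Fact Z2_integral : GRing.integral_domain_axiom Z2adic.
Proof.
move=> x y xy0; apply/norP => -[/Z2_neq0[a xa] /Z2_neq0[b yb]].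
pose m := (a + b).+1.
have am : (a <= m)%N by rewrite leqW ?leq_addr.
have bm : (b <= m)%N by rewrite leqW ?leq_addl.
have: (2 ^ m.+1 %| Z2mod m x * Z2mod m y)%N.
  have /(congr1 (@nat_of_ord _)) : Z2mod m x * Z2mod m y = 0.
    by rewrite -rmorphM xy0 rmorph0.
  by move=> /= e; rewrite /dvdn -[X in (_ %% X)%N](Zp_cast (ltn_exp2S m)) e.
have := xa _ am; have := yb _ bm.
set u := nat_of_ord _; set v := nat_of_ord _ => yu xv.
have u0 : (0 < u)%N by case: u yu => //; rewrite dvdn0.
have v0 : (0 < v)%N by case: v xv => //; rewrite dvdn0.
rewrite !pfactor_dvdn ?muln_gt0 ?u0 ?v0 // in yu xv *.
rewrite lognM // -!ltnNge !ltnS in yu xv *.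
by apply/negP; rewrite -ltnNge ltnS (leq_trans (leq_add xv yu)) // leqW.
Qed.

Definition Z2unit : pred Z2adic := fun x => `[< exists y, y * x = 1 >].
Definition Z2inv (x : Z2adic) : Z2adic := xget x [set y | y * x = 1].

Fact Z2mulVr : {in Z2unit, left_inverse 1 Z2inv *%R}.
Proof.
move=> x /asboolP[y yx]; rewrite /Z2inv.
exact: (@xgetI _ x [set z | z * x = 1] y yx).
Qed.

Fact Z2unitP (x y : Z2adic) : y * x = 1 -> Z2unit x.
Proof. by move=> yx; apply/asboolP; exists y. Qed.

Fact Z2inv_out : {in [predC Z2unit], Z2inv =1 id}.
Proof.
move=> x /negP nux; apply: xgetPN => y yx; apply: nux.
exact: Z2unitP yx.
Qed.

HB.instance Definition _ :=
  GRing.ComNzRing_hasMulInverse.Build Z2adic Z2mulVr Z2unitP Z2inv_out.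
HB.instance Definition _ :=
  GRing.ComUnitRing_isIntegral.Build Z2adic Z2_integral.


End TwoAdic.

Notation Q2adic := {fraction Z2adic}.

Section Integers.
Variable K : fieldExtType Q2adic.

Definition Z2_to_K : Z2adic -> K := in_alg K \o @tofrac Z2adic.
HB.instance Definition _ := GRing.RMorphism.on Z2_to_K.

Lemma Z2_to_K_inj : injective Z2_to_K.
Proof.
apply: inj_comp; first exact: (fmorph_inj (in_alg K)).
by move=> x y /eqP; rewrite tofrac_eq => /eqP.
Qed.

Definition O_pred : {pred K} := fun x => `[< integralOver Z2_to_K x >].

Fact O_pred_subring : subring_closed O_pred.
Proof.
split; first by apply/asboolP/integral1.
  by move=> x y /asboolP ? /asboolP ?; apply/asboolP/integral_sub.
by move=> x y /asboolP ? /asboolP ?; apply/asboolP/integral_mul.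
Qed.
HB.instance Definition _ := GRing.isSubringClosed.Build K O_pred O_pred_subring.

Definition OK := {x : K | x \in O_pred}.
HB.instance Definition _ := SubType.on OK.
HB.instance Definition _ := Choice.on OK.
HB.instance Definition _ := [SubChoice_isSubComNzRing of OK by <:].

Lemma quarter_nonintegral (y : K) : integralOver Z2_to_K y -> 4 * y != 1.
Proof.
move=> [p mp /rootP]; apply: contra_eqN => /eqP y4.
have sp : (0 < size p)%N by rewrite size_poly_gt0 monic_neq0.
rewrite horner_coef size_map_poly_id0; last first.
  by rewrite (monicP mp) rmorph1 oner_eq0.
rewrite -(prednK sp) big_ord_recr /=.
set m := (size p).-1.
have -> : (map_poly Z2_to_K p)`_m = 1.
  by rewrite coef_map /= -lead_coefE (monicP mp) rmorph1.
apply/eqP => /(congr1 ( *%R (4 ^+ m))).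
have y4m i : (i <= m)%N -> 4 ^+ m * y ^+ i = Z2_to_K (4 ^+ (m - i)).
  move=> im; rewrite -{1}(subnK im) exprD -mulrA -exprMn y4 expr1n mulr1.
  by rewrite rmorphXn rmorph_nat.
rewrite mulr0 mulrDr mul1r y4m // subnn expr0 mulr_sumr.
rewrite (eq_bigr (fun i : 'I_m =>
  Z2_to_K (2 * (2 * 4 ^+ (m - i).-1 * p`_i)))); last first.
  move=> i _; rewrite coef_map mulrCA /= y4m 1?ltnW //.
  rewrite -rmorphM /= -[in LHS](prednK (n := m - i)) ?subn_gt0 //.
  by rewrite exprS [p`_i * _]mulrC !mulrA -natrM.
rewrite -rmorph_sum -rmorphD -(rmorph0 Z2_to_K) => /Z2_to_K_inj.
rewrite -mulr_sumr => /(congr1 (Z2mod 0)).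
by rewrite rmorphD rmorphM rmorph1 rmorph_nat.
Qed.

(* [mK] is 2 O_K, the maximal ideal when K is unramified; then [mK2] = 4 O_K is
   its square. *)
Definition mK : {pred OK} := fun x => `[< exists y, x = 2 * y >].
Definition mK2 : {pred OK} := fun x => `[< exists y, x = 4 * y >].

Fact mK2_ideal : idealr_closed mK2.
Proof.
split.
- by apply/asboolP; exists 0; rewrite mulr0.
- apply/asboolP => -[y /(congr1 val)]; rewrite rmorph1 rmorphM rmorph_nat => e.
  by have /negP[] := quarter_nonintegral (asboolW (valP y)); apply/eqP/esym.
- move=> a _ _ /asboolP[y ->] /asboolP[z ->]; apply/asboolP.
  by exists (a * y + z); rewrite mulrDr [4 * (a * y)]mulrCA.
Qed.
HB.instance Definition _ := isIdealr.Build OK mK2 mK2_ideal.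

Definition RK : Type := {ideal_quot mK2}.
HB.instance Definition _ := GRing.ComNzRing.on RK.

End Integers.

(* O_K is local, so its maximal ideal is the set of its non-units; K is
   unramified when 2 generates that ideal. *)
Definition unramified (K : fieldExtType Q2adic) : Prop :=
  forall x : OK K, ~ (exists y, y * x = 1) <-> x \in @mK K.

Section Trace.
Variable K : fieldExtType Q2adic.

Definition trK (x : K) : Q2adic :=
  \tr (passmx.mxof (vbasis {:K}) (vbasis {:K}) (amull x)).

(* The trace of R over Z / 4 is the reduction mod 4 of Tr_(K / Q_2), which maps
   O_K to Z_2 (so the default value 0 is not used) and 4 O_K to 4 Z_2 (so the
   representative is irrelevant). *)
Definition trR (z : RK K) : 'Z_4 :=
  Z2mod 1 (xget 0 [set a : Z2adic | tofrac a = trK (val (repr z))]).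

Definition expi (Rr : realType) (t : Rr) : Rr[i] := (cos t +i* sin t)%C.

Definition psiK (Rr : realType) (z : RK K) : Rr[i] :=
  expi (2 * pi / 4 * (trR z)%:R).

End Trace.

Section Mod2.
Variables (R : comNzRingType) (W : lmodType R).

Definition twice : {pred W} := fun v => `[< exists w, v = 2 *: w >].

Fact twice_zmod_closed : zmod_closed twice.
Proof.
split; first by apply/asboolP; exists 0; rewrite scaler0.
move=> _ _ /asboolP[v ->] /asboolP[w ->]; apply/asboolP.
by exists (v - w); rewrite scalerBr.
Qed.
HB.instance Definition _ := GRing.isZmodClosed.Build W twice twice_zmod_closed.

Definition mod2 : Type := @Quotient.quot W twice.
HB.instance Definition _ := GRing.Zmodule.on mod2.

Definition pi2 (v : W) : mod2 := \pi_(@Quotient.quot W twice)%qT v.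
Definition repr2 (v : mod2) : W := repr (v : @Quotient.quot W twice).

Lemma repr2K : cancel repr2 pi2. Proof. exact: reprK. Qed.

Fact pi2_zmod_morphism : zmod_morphism pi2.
Proof. exact: (raddfB (\pi_(@Quotient.quot W twice))%qT). Qed.
HB.instance Definition _ :=
  GRing.isZmodMorphism.Build W mod2 pi2 pi2_zmod_morphism.

Lemma pi2P (v w : W) : pi2 v = pi2 w <-> exists u, v = w + 2 *: u.
Proof.
split.
  move=> /eqP; rewrite -[_ == _]Quotient.idealrBE => /asboolP[u vw].
  by exists u; rewrite -vw addrC subrK.
move=> [u ->]; apply/eqP; rewrite -[_ == _]Quotient.idealrBE.
by apply/asboolP; exists u; rewrite addrC addKr.
Qed.

Lemma repr2_pi (v : W) : exists u, repr2 (pi2 v) = v + 2 *: u.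
Proof. by apply/pi2P; rewrite repr2K. Qed.

Definition scale2 (r : R) (v : mod2) : mod2 := pi2 (r *: repr2 v).

Lemma scale2E r v : scale2 r (pi2 v) = pi2 (r *: v).
Proof.
have [u e] := repr2_pi v; apply/pi2P; exists (r *: u).
by rewrite e scalerDr !scalerA mulrC.
Qed.

Fact scale2A a b v : scale2 a (scale2 b v) = scale2 (a * b) v.
Proof. by rewrite -[v]repr2K !scale2E scalerA. Qed.
Fact scale21 : left_id 1 scale2.
Proof. by move=> v; rewrite -[v]repr2K !scale2E scale1r. Qed.
Fact scale2Dr : right_distributive scale2 +%R.
Proof.
move=> a v w; rewrite -[v]repr2K -[w]repr2K -raddfD.
by rewrite !scale2E scalerDr raddfD.
Qed.
Fact scale2Dl v : {morph scale2^~ v: a b / a + b}.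
Proof. by move=> a b; rewrite -[v]repr2K !scale2E scalerDl raddfD. Qed.
HB.instance Definition _ :=
  GRing.Zmodule_isLmodule.Build R mod2 scale2A scale21 scale2Dr scale2Dl.

(* The form on W / 2 W to which 2 b factors; independent of the representatives
   when 4 = 0 in R, see [form2E]. *)
Definition form2 (b : W -> W -> R) (v w : mod2) : R :=
  2 * b (repr2 v) (repr2 w).

Hypothesis R4 : (4 : R) = 0.
Variable b : {biscalar W}.

Lemma form2E v w : form2 b (pi2 v) (pi2 w) = 2 * b v w.
Proof.
rewrite /form2; have [u ->] := repr2_pi v; have [t ->] := repr2_pi w.
have R22 : 2 * 2 = 0 :> R by rewrite -natrM.
rewrite linearDl /= !linearDr /= !linearZr_LR /= !linearZl_LR /=.
by rewrite !mulrDr !mulrA !R22 !mul0r !addr0.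
Qed.

Lemma form2Dl v v' w : form2 b (v + v') w = form2 b v w + form2 b v' w.
Proof.
rewrite -[v]repr2K -[v']repr2K -[w]repr2K -raddfD !form2E.
by rewrite linearDl mulrDr.
Qed.

Lemma form2Dr v w w' : form2 b v (w + w') = form2 b v w + form2 b v w'.
Proof.
rewrite -[v]repr2K -[w']repr2K -[w]repr2K -raddfD !form2E.
by rewrite linearDr mulrDr.
Qed.

End Mod2.

Section Lagrangian.
Variables (R : comNzRingType) (W : lmodType R) (b : W -> W -> R).

(* For W / 2 W, on which R = O_K / 4 O_K acts through k = O_K / 2 O_K, these are
   the k-linear subspaces. *)
Definition submodule (A : set W) : Prop :=
  A 0 /\ forall (r : R) v w, A v -> A w -> A (r *: v + w).

Definition orthogonal (A : set W) : set W := [set w | forall a, A a -> b a w = 0].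

Definition lagrangian (A : set W) : Prop := submodule A /\ orthogonal A = A.

(* Over a finite ring, injectivity of v |-> b v _ on a free module of finite
   rank already makes it an isomorphism onto the dual. *)
Definition symplectic : Prop :=
  (forall v, b v v = 0) /\ (forall v, (forall w, b v w = 0) -> v = 0).
End Lagrangian.

Section HPower.
Variables (m : nat) (G : groupType).

Definition gpow : Type := {ffun 'I_m -> G}.
HB.instance Definition _ := Choice.on gpow.

Definition gpow1 : gpow := [ffun=> 1%g].
Definition gpowV (g : gpow) : gpow := [ffun i => (g i)^-1%g].
Definition gpowM (g h : gpow) : gpow := [ffun i => (g i * h i)%g].

Fact gpowA : associative gpowM.
Proof. by move=> f g h; apply/ffunP => i; rewrite !ffunE mulgA. Qed.
Fact gpow1M : left_id gpow1 gpowM.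
Proof. by move=> f; apply/ffunP => i; rewrite !ffunE mul1g. Qed.
Fact gpowM1 : right_id gpow1 gpowM.
Proof. by move=> f; apply/ffunP => i; rewrite !ffunE mulg1. Qed.
Fact gpowVM : left_inverse gpow1 gpowV gpowM.
Proof. by move=> f; apply/ffunP => i; rewrite !ffunE mulVg. Qed.
Fact gpowMV : right_inverse gpow1 gpowV gpowM.
Proof. by move=> f; apply/ffunP => i; rewrite !ffunE mulgV. Qed.
HB.instance Definition _ :=
  isGroup.Build gpow gpowA gpow1M gpowM1 gpowVM gpowMV.
End HPower.

Section Bundles.
Variables (B : Type) (G : groupType) (F : fieldType).

Record bundle := Bundle {
  fiber : B -> lmodType F;
  act : forall L, G -> fiber L -> fiber L;
  act_linear : forall L g, linear (@act L g);
  act1 : forall L x, @act L 1%g x = x;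
  actM : forall L g h x, @act L (g * h)%g x = act g (act h x)
}.

Definition trivialization (E : bundle)
    (T : forall M L, fiber E L -> fiber E M) : Prop :=
  [/\ forall M L, linear (T M L),
      forall M L, bijective (T M L),
      forall M L g x, T M L (act g x) = act g (T M L x)
    & forall N M L x, T N M (T M L x) = T N L x].
End Bundles.

Section TensorPower.
Variables (Rr : realType) (X : Type) (m : nat).
Local Notation C := (Rr[i]).

Definition pure_tensor (f : 'I_m -> X -> C) : {ffun 'I_m -> X} -> C :=
  fun x => \prod_i f i (x i).

(* The tensor power of a space S of functions on X, embedded as usual in the
   functions on X ^ m: the span of the products f_1(x_1) ... f_m(x_m), f_i in S. *)
Definition tensor_power (S : set (X -> C)) : {pred ({ffun 'I_m -> X} -> C)} :=
  fun phi => `[< exists s : seq (C * ('I_m -> X -> C)),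
    (forall u, u \in s -> forall i, S (u.2 i)) /\
    phi = \sum_(u <- s) u.1 *: pure_tensor u.2 >].

Fact tensor_power_submod S : submod_closed (tensor_power S).
Proof.
split; first by apply/asboolP; exists [::]; rewrite big_nil.
move=> a phi chi /asboolP[s [Ss ->]] /asboolP[t [St ->]]; apply/asboolP.
exists ([seq (a * u.1, u.2) | u <- s] ++ t); split.
  move=> u; rewrite mem_cat => /orP[/mapP[v vs ->] | /St //].
  exact: Ss vs.
rewrite big_cat big_map scaler_sumr; congr (_ + _).
by apply: eq_bigr => u _; rewrite scalerA.
Qed.
HB.instance Definition _ S :=
  GRing.isSubmodClosed.Build C _ (tensor_power S) (tensor_power_submod S).

Definition tpow (S : set (X -> C)) :=
  {phi : {ffun 'I_m -> X} -> C | phi \in tensor_power S}.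
HB.instance Definition _ S := SubType.on (tpow S).
HB.instance Definition _ S := Choice.on (tpow S).
HB.instance Definition _ S := [SubChoice_isSubLmodule of tpow S by <:].
End TensorPower.

Lemma RK4 (K : fieldExtType Q2adic) : 4 = 0 :> RK K.
Proof.
rewrite -(rmorph_nat (\pi_(RK K))%qT) -(rmorph0 (\pi_(RK K))%qT).
apply/eqP; rewrite -[_ == _]Quotient.idealrBE; apply/asboolP.
by exists 1; rewrite mulr1 subr0.
Qed.

Section Heisenberg.
Variables (R : comNzRingType) (L0 M0 : vectType R).
Local Notation Vt := (L0 * M0)%type.
Local Notation V := (mod2 Vt).

(* The type does not depend on [R4] and [om], but its group law does. *)
Definition Heis (R4 : 4 = 0 :> R) (om : {biscalar Vt}) : Type := (V * R)%type.

Variables (R4 : 4 = 0 :> R) (om : {biscalar Vt}).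
Local Notation H := (Heis R4 om).
HB.instance Definition _ := Choice.on H.

Definition omega : V -> V -> R := form2 om.

Definition beta_t (x y : Vt) : R := om (x.1, 0) (0, y.2).

Fact beta_t_bilinear : bilinear_for *%R *%R beta_t.
Proof.
split.
  move=> y a x x'; rewrite /beta_t /= -linearZl_LR -linearDl /=.
  by congr (om _ _); apply/eqP; rewrite xpair_eqE /= scaler0 addr0 !eqxx.
move=> x a y y'; rewrite /beta_t /= -linearZr_LR -linearDr /=.
by congr (om _ _); apply/eqP; rewrite xpair_eqE /= scaler0 addr0 !eqxx.
Qed.
HB.instance Definition _ :=
  bilinear_isBilinear.Build R Vt Vt R *%R *%R beta_t beta_t_bilinear.

Definition beta : V -> V -> R := form2 beta_t.

Lemma betaDl u v w : beta (u + v) w = beta u w + beta v w.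
Proof. exact: (form2Dl R4 beta_t). Qed.
Lemma betaDr u v w : beta u (v + w) = beta u v + beta u w.
Proof. exact: (form2Dr R4 beta_t). Qed.
Lemma beta0v v : beta 0 v = 0.
Proof. by apply: (addrI (beta 0 v)); rewrite -betaDl !addr0. Qed.
Lemma betav0 v : beta v 0 = 0.
Proof. by apply: (addrI (beta v 0)); rewrite -betaDr !addr0. Qed.
Lemma betaNl v w : beta (- v) w = - beta v w.
Proof. by apply/eqP; rewrite -addr_eq0 -betaDl addNr beta0v. Qed.
Lemma betaNr v w : beta v (- w) = - beta v w.
Proof. by apply/eqP; rewrite -addr_eq0 -betaDr addNr betav0. Qed.

Definition heis1 : H := (0, 0).
Definition heisV (h : H) : H := (- h.1, - h.2 + beta h.1 h.1).
Definition heisM (g h : H) : H := (g.1 + h.1, g.2 + h.2 + beta g.1 h.1).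

Fact heisA : associative heisM.
Proof.
move=> [u x] [v y] [w z]; congr (_, _); rewrite /= ?addrA //.
rewrite betaDl betaDr -!addrA; congr (_ + (_ + _)); rewrite [RHS]addrCA.
by congr (_ + _); rewrite addrC addrA.
Qed.
Fact heis1M : left_id heis1 heisM.
Proof. by move=> [v z]; rewrite /heisM /= beta0v !add0r addr0. Qed.
Fact heisM1 : right_id heis1 heisM.
Proof. by move=> [v z]; rewrite /heisM /= betav0 !addr0. Qed.
Fact heisVM : left_inverse heis1 heisV heisM.
Proof.
move=> [v z]; rewrite /heisM /heisV /= addNr betaNl.
by rewrite addrAC addrK addNr.
Qed.
Fact heisMV : right_inverse heis1 heisV heisM.
Proof.
move=> [v z]; rewrite /heisM /heisV /= subrr betaNr.
by rewrite addrA subrr add0r subrr.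
Qed.
HB.instance Definition _ := isGroup.Build H heisA heis1M heisM1 heisVM heisMV.

Definition center (z : R) : H := (0, z).

Record ELag := MkELag {
  lag : set V;
  lagP : lagrangian omega lag;
  sect : lag -> H;
  sectP : forall l : lag, (sect l).1 = val l;
  (* l3 is l1 + l2 as an element of L *)
  sectM : forall l1 l2 l3 : lag,
    val l3 = val l1 + val l2 -> sect l3 = (sect l1 * sect l2)%g
}.

Definition transversal (M L : ELag) : Prop :=
  forall v, exists2 m, lag M m & exists2 l, lag L l & v = m + l.

Variables (Rr : realType) (psi : R -> Rr[i]).
Local Notation C := (Rr[i]).

Definition HL (L : ELag) : set (H -> C) :=
  [set f | forall (z : R) (l : lag L) (h : H),
     f (center z * sect l * h)%g = psi z * f h].

(* The sums over [lag M] are finite in the intended case of a finite ring R. *)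
Definition FML (M : ELag) (f : H -> C) : H -> C :=
  fun h => \sum_(m \in [set: lag M]) f (sect m * h)%g.

Definition translate m (g : gpow m H) (phi : {ffun 'I_m -> H} -> C) :
  {ffun 'I_m -> H} -> C := fun h => phi ((h : gpow m H) * g)%g.

Lemma translate_tpow m (L : ELag) g phi :
  phi \in tensor_power (HL L) -> translate g phi \in @tensor_power Rr H m (HL L).
Proof.
move=> /asboolP[s [Hs ->]]; apply/asboolP.
exists [seq (u.1, fun i h => u.2 i (h * g i)%g) | u <- s]; split.
  move=> _ /mapP[u us ->] i z l h /=.
  by rewrite -mulgA (Hs u us i z l).
apply: funext => h; rewrite /translate big_map !fct_sumE.
apply: eq_bigr => u _; congr (_ * _).
by apply: eq_bigr => i _; rewrite ffunE.
Qed.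

Definition act_tpow m (L : ELag) (g : gpow m H) (x : tpow m (HL L)) :
  tpow m (HL L) := Sub (translate g (val x)) (translate_tpow g (valP x)).

Fact act_tpow_linear m L g : linear (@act_tpow m L g).
Proof. by move=> a x y; apply: val_inj. Qed.
Fact act_tpow1 m L x : @act_tpow m L 1%g x = x.
Proof. by apply: val_inj; apply: funext => h; rewrite /= /translate mulg1. Qed.
Fact act_tpowM m L g h x :
  @act_tpow m L (g * h)%g x = act_tpow g (act_tpow h x).
Proof. by apply: val_inj; apply: funext => k; rewrite /= /translate mulgA. Qed.

Definition Hbundle m : bundle ELag (gpow m H) C :=
  Bundle (@act_tpow_linear m) (@act_tpow1 m) (@act_tpowM m).

(* T M L is (-1) ^ (d n) / |M| ^ 2 times the fourth tensor power of F_(M, L),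
   the linear map sending f_1 (x) ... (x) f_4 to F f_1 (x) ... (x) F f_4. As T is
   linear in a trivialization, its values on pure tensors determine it. *)
Definition extends_T (d n : nat)
    (T : forall M L, fiber (Hbundle 4) L -> fiber (Hbundle 4) M) : Prop :=
  forall M L, transversal M L ->
  forall (f : 'I_4 -> H -> C) (x : fiber (Hbundle 4) L),
    (forall i, HL L (f i)) -> val x = pure_tensor f ->
    val (T M L x) = ((-1) ^+ (d * n) / (#|` fset_set (lag M)|)%:R ^+ 2)
       *: pure_tensor (fun i => FML M (f i)).

End Heisenberg.

(* Main.v *)
Require Import Defs.
From HB Require Import structures.
From mathcomp Require Import all_boot all_order all_algebra all_field finmap.
From mathcomp Require Import boolp classical_sets functions cardinality fsbigop.
From mathcomp Require Import generic_quotient ring_quotient.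
From mathcomp Require Import reals trigo complex.
From mathcomp Require Import ring zify.

Set Implicit Arguments.
Unset Strict Implicit.
Unset Printing Implicit Defensive.

Import Order.TTheory GRing.Theory Num.Theory.
Local Open Scope classical_set_scope.
Local Open Scope ring_scope.

(** By irreducibility, an intertwining operator between two of the spaces H_L
    is unique up to a scalar; the theorem asks for a coherent choice of scalars
    after passing to fourth tensor powers. The choice comes from an integral
    structure. Call an intertwiner an integral isometry when it is unitary and
    preserves the functions with values in Z[i, 1/2] ([integral_isometry]).
    These operators are stable under composition. The scalar relating two of
    them is an element of Z[i, 1/2] of absolute value 1, and such an element is
    a fourth root of unity, because 1 + i is the only prime of Z[i] above 2
    ([gaussian_norm_exp2], [dyadic_norm1], [isom_unique]). The fourth tensor
    power of an integral isometry from H_L to H_M therefore depends only on M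
    and L, and the cocycle identity for these tensor powers is automatic: no
    Gauss sum has to be evaluated.

    When M and L are transversal, F_(M, L) multiplies square norms by
    |M| = 2 ^ (d n) ([avg_norm], [gsize_exp]), so (1 + i) ^ (- d n) F_(M, L) is
    an integral isometry. Since (1 + i) ^ 4 = - 4, its fourth tensor power is
    (-1) ^ (d n) / |M| ^ 2 times that of F_(M, L), as required. Any two
    enhanced Lagrangians M and L have a common transversal P
    ([common_disjoint]). This gives an integral isometry for every pair, and
    forces T_(M, L) = T_(M, P) T_(P, L), hence uniqueness.

    Two facts about R = O_K / 4 O_K are used: it is local, with maximal ideal
    2 R and a residue field of 2 ^ d elements, and psi is not trivial on 2 R.
    The first holds because a basis of O_K / 2 O_K over F_2 lifts to a basis of
    O_K over Z_2 ([integral_basis]), the second because the trace of the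
    residue field is not zero ([integral_trace]), which the Moore matrix of a
    basis shows ([red_trace]). *)

(** * 2-adic integers *)

Lemma natZ2_eq0 n m : (2 ^ n.+1 %| m)%N -> m%:R = 0 :> 'Z_(2 ^ n.+1).
Proof.
by move=> /dvdnP[q ->]; rewrite natrM [X in _ * X]pchar_Zp ?ltn_exp2S ?mulr0.
Qed.

Lemma Z2mod_lt n (x : Z2adic) : (Z2mod n x < 2 ^ n.+1)%N.
Proof. by rewrite -[X in (_ < X)%N]Zp_cast ?ltn_exp2S. Qed.

Lemma val_natZ2 n m : ((m%:R : 'Z_(2 ^ n.+1)) : nat) = (m %% 2 ^ n.+1)%N.
Proof. by rewrite val_Zp_nat ?ltn_exp2S. Qed.

Lemma Z2mod_succ n (x : Z2adic) :
  (Z2mod n.+1 x : nat) = (Z2mod n x + (Z2mod n.+1 x %/ 2 ^ n.+1) * 2 ^ n.+1)%N.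
Proof.
rewrite addnC {1}(divn_eq (Z2mod n.+1 x) (2 ^ n.+1)); congr (_ + _)%N.
by rewrite (Z2mod_le x (leqnSn n)) modn_small // Z2mod_lt.
Qed.

(** Halving loses one level of precision, so the half of [a] modulo
    [2 ^ n.+1] is read from [a] modulo [2 ^ n.+2]. *)
Lemma Z2_even (a : Z2adic) : Z2mod 0 a = 0 -> exists b, a = 2 * b.
Proof.
move=> a0; have ev n : ~~ odd (Z2mod n a).
  by have := Z2mod_le a (leq0n n); rewrite a0 expn1 !modn2; case: odd.
pose b n : 'Z_(2 ^ n.+1) := (Z2mod n.+1 a)./2%:R.
have cb : coherent b.
  have halfS u q n : ((u + q * 2 ^ n.+2)./2 = u./2 + q * 2 ^ n.+1)%N.
    by rewrite [(2 ^ _)%N]expnS mulnCA mul2n halfD doubleK odd_double andbF.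
  move=> n; rewrite /b val_natZ2 natZ2_mod [in RHS]Z2mod_succ halfS natrD.
  by rewrite [X in _ = _ + X]natZ2_eq0 ?dvdn_mull ?addr0.
exists (MkZ2 cb); apply: Z2P => n; rewrite rmorphM rmorph_nat /= /Z2mod /= /b.
rewrite -natrM mul2n halfK (negbTE (ev _)) subn0.
exact: (coherentP a n).
Qed.

Lemma Z2_bit (a : Z2adic) : exists (c : bool) b, a = c%:R + 2 * b.
Proof.
pose c := Z2mod 0 a != 0; exists c.
have [b ab] : exists b, a - c%:R = 2 * b; last first.
  by exists b; rewrite -ab addrC subrK.
have bitE (z : 'Z_2) : z = (z != 0)%:R by case: z => -[|[|?]] ?; apply/val_inj.
apply: Z2_even; rewrite rmorphB rmorph_nat; apply/eqP; rewrite subr_eq0.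
by apply/eqP; apply: bitE.
Qed.

Lemma Z2mod_exp m b : Z2mod m (2 ^+ m.+1 * b) = 0.
Proof. by rewrite rmorphM -natrX rmorph_nat natZ2_eq0 ?mul0r. Qed.

Lemma Z2_separated (a : Z2adic) : (forall m, exists b, a = 2 ^+ m * b) -> a = 0.
Proof.
move=> h; apply: Z2P => n; have [b ->] := h n.+1.
by rewrite Z2mod_exp rmorph0.
Qed.

Lemma Z2_factor (a : Z2adic) : a != 0 ->
  exists j b, a = 2 ^+ j * (1 + 2 * b).
Proof.
move=> a0; pose P m := `[< ~ exists b, a = 2 ^+ m * b >].
have exP : exists m, P m.
  apply/not_existsP => h; case/eqP: a0; apply: Z2_separated => m.
  by apply: contrapT => /asboolP; apply: h.
have [[|m] /asboolP Pm mmin] := ex_minnP exP.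
  by case: Pm; exists a; rewrite mul1r.
have [b ab] : exists b, a = 2 ^+ m * b.
  by apply: contrapT => /asboolP /mmin; rewrite ltnn.
have [[] [b' bb]] := Z2_bit b; first by exists m, b'; rewrite ab bb.
by case: Pm; exists b'; rewrite ab bb add0r exprSr mulrA.
Qed.

Section Digits.
Local Open Scope nat_scope.
Definition dsum (c : nat -> bool) n := \sum_(j < n) c j * 2 ^ j.

Lemma dsumS c n : dsum c n.+1 = c 0 + 2 * dsum (c \o S) n.
Proof.
rewrite /dsum big_ord_recl muln1 big_distrr; congr addn.
by apply: eq_bigr => j _; rewrite lift0 expnS mulnCA.
Qed.

Lemma dsum_coherent c : coherent (fun n => ((dsum c n.+1)%:R)%R).
Proof.
move=> n; rewrite val_natZ2 natZ2_mod [in RHS]/dsum big_ord_recr natrD.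
by rewrite [X in (_ + X)%R]natZ2_eq0 ?addr0 // dvdn_mull.
Qed.

End Digits.

(** The sum of the series of the [c j * 2 ^ j], which converges because the
    ring is an inverse limit. *)
Definition digits c : Z2adic := MkZ2 (dsum_coherent c).

Lemma Z2mod_digits n c : Z2mod n (digits c) = (dsum c n.+1)%:R.
Proof. by []. Qed.

Lemma digits_rec c : digits c = (c 0)%:R + 2 * digits (c \o S).
Proof.
apply: Z2P => n; rewrite rmorphD rmorphM !rmorph_nat [LHS]Z2mod_digits.
rewrite [X in _ = _ + 2 * X]Z2mod_digits.
rewrite dsumS natrD natrM [in RHS]/dsum big_ord_recr [in RHS]natrD mulrDr.
rewrite -[X in _ = _ + (_ + X)]natrM [X in _ = _ + (_ + X)]natZ2_eq0 ?addr0 //.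
by rewrite mulnCA -expnS dvdn_mull.
Qed.

(** * Integral elements *)

Lemma fraction_num (D : idomainType) (x : {fraction D}) :
  exists a b, b != 0 /\ tofrac b * x = tofrac a.
Proof.
elim/quotW: x => r; exists (frac r).1, (frac r).2; split.
  exact: denom_ratioP.
rewrite !piE /FracField.mulf; apply/eqmodP; rewrite /= FracField.equivfE.
by rewrite !numden_Ratio ?mulf_neq0 ?oner_eq0 ?denom_ratioP // !mul1r mulr1
  mulrC.
Qed.

Lemma common_denominator (D : idomainType) (s : nat -> {fraction D}) n :
  exists2 b, b != 0 &
    forall i, (i < n)%N -> exists a, tofrac b * s i = tofrac a.
Proof.
elim: n => [|n [b b0 IHn]]; first by exists 1; rewrite ?oner_eq0.
have [a [c [c0 ec]]] := fraction_num (s n).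
exists (c * b) => [|i]; first by rewrite mulf_neq0.
rewrite ltnS leq_eqVlt => /predU1P[-> | /IHn[a' e]].
  by exists (b * a); rewrite [c * b]mulrC !rmorphM /= -ec mulrA.
by exists (c * a'); rewrite !rmorphM /= -e mulrA.
Qed.

Section Integers.
Variable K : fieldExtType Q2adic.
Local Notation iota := (@Z2_to_K K).

(** If [z] is a root of the monic polynomial of degree [n] with coefficients
    [p_i], then [c * z] is a root of the one with coefficients
    [c ^ (n - i) * p_i], in which a power of [c] clears every denominator. *)
Lemma clear_denominators (z : K) :
  exists2 c, c != 0 & integralOver iota (iota c * z).
Proof.
have [/polyOver1P[p Dp] mp] := (minPolyOver 1 z, monic_minPoly 1 z).
have pz : root (map_poly (in_alg K) p) z by rewrite -Dp root_minPoly.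
have {mp}mp : p \is monic by rewrite -(map_monic (in_alg K)) -Dp.
pose n := (size p).-1.
have sp : size p = n.+1 by rewrite prednK // size_poly_gt0 monic_neq0.
have [b b0 hb] := common_denominator (fun i => p`_i) n.
exists b => //; set c := iota b.
pose q := \poly_(i < n.+1) (in_alg K p`_i * c ^+ (n - i)).
have qn : q`_n = 1.
  by rewrite coef_poly leqnn subnn mulr1 -(rmorph1 (in_alg K)) /n -lead_coefE
    (monicP mp).
have mq : q \is monic.
  rewrite monicE lead_coefE; have -> : size q = n.+1; last by rewrite qn.
  by apply/eqP; rewrite eqn_leq size_poly ltnNge;
    apply/negP => /leq_sizeP/(_ n (leqnn n))/eqP; rewrite qn oner_eq0.
apply: (integral_root_monic mq).
  apply/rootP; rewrite horner_poly.
  have /rootP := pz; rewrite horner_coef size_map_poly sp => e.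
  transitivity (c ^+ n * 0); last by rewrite mulr0.
  rewrite -[in RHS]e mulr_sumr; apply: eq_bigr => i _.
  have cn : c ^+ n = c ^+ (n - i) * c ^+ i by rewrite -exprD subnK // -ltnS.
  by rewrite coef_map /= exprMn cn [RHS]mulrACA [X in _ = X * _]mulrC.
apply/integral_poly => i; rewrite coef_poly ltnS; case: ifP => [|_]; last first.
  exact: integral0.
rewrite leq_eqVlt => /predU1P[-> | lt_in].
  have -> : p`_n = 1 by rewrite /n -lead_coefE (monicP mp).
  by rewrite rmorph1 mul1r subnn; apply: integral1.
have [a ea] := hb i lt_in.
rewrite -subnSK // exprS mulrA [_ * c]mulrC.
have -> : c * in_alg K p`_i = iota a.
  by rewrite -[RHS]/(in_alg K (tofrac a)) -ea rmorphM.
by rewrite -rmorphXn -rmorphM; apply: integral_id.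
Qed.

Fact Z2_to_O_subproof a : iota a \in @O_pred K.
Proof. exact/asboolP/integral_id. Qed.
Definition Z2_to_O a : OK K := Sub (iota a) (Z2_to_O_subproof a).

Fact Z2_to_O_zmod_morphism : zmod_morphism Z2_to_O.
Proof. by move=> a b; apply: val_inj; rewrite /= rmorphB. Qed.
Fact Z2_to_O_monoid_morphism : monoid_morphism Z2_to_O.
Proof. by split=> [|a b]; apply: val_inj; rewrite /= ?rmorph1 ?rmorphM. Qed.
HB.instance Definition _ :=
  GRing.isZmodMorphism.Build _ _ Z2_to_O Z2_to_O_zmod_morphism.
HB.instance Definition _ :=
  GRing.isMonoidMorphism.Build _ _ Z2_to_O Z2_to_O_monoid_morphism.

Lemma iota_scale a (z : K) : iota a * z = tofrac a *: z.
Proof. exact: mulr_algl. Qed.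

Lemma K_nat2_neq0 : (2 : K) != 0.
Proof.
rewrite -(rmorph_nat iota) -(rmorph0 iota) (inj_eq (@Z2_to_K_inj K)).
by apply/eqP => /(congr1 (Z2mod 1)).
Qed.

Lemma OK_mulI2 : injective ( *%R (2 : OK K)).
Proof.
move=> x y /(congr1 val); rewrite !rmorphM !rmorph_nat.
by move=> /(mulfI K_nat2_neq0)/val_inj.
Qed.

Lemma OK_mulIX2 m : injective ( *%R (2 ^+ m : OK K)).
Proof.
elim: m => [|m IHm] x y; first by rewrite !mul1r.
by rewrite exprS -!mulrA => /OK_mulI2/IHm.
Qed.

(** An inverse of 2 has the non-integral square 1 / 4. *)
Lemma OK_2_nonunit (y : OK K) : 2 * y <> 1.
Proof.
move=> e; have := quarter_nonintegral (asboolW (valP (y * y))).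
have: (2 * y) * (2 * y) = 1 by rewrite e mul1r.
rewrite mulrACA -natrM.
by move=> /(congr1 val); rewrite rmorphM rmorph_nat rmorph1 => ->; rewrite eqxx.
Qed.

Hypothesis hK : unramified K.

(** A non-unit is even, and an even element that is also odd would make 2
    invertible. *)
Lemma OK_odd_unit (b : Z2adic) : exists y, y * Z2_to_O (1 + 2 * b) = 1.
Proof.
apply: contrapT => /hK /asboolP[y].
rewrite rmorphD rmorph1 rmorphM rmorph_nat => e.
by apply: (@OK_2_nonunit (y - Z2_to_O b)); rewrite mulrBr -e addrK.
Qed.

(** If [x] is nonzero, some nonzero element of Z_2 is a multiple of [x]; it is
    a power of 2 times a unit, which bounds the powers of 2 dividing [x]. *)
Lemma OK_separated (x : OK K) : (forall m, exists y, x = 2 ^+ m * y) -> x = 0.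
Proof.
move=> xdiv; apply/eqP/negP => /negP x0.
have [c c0 /asboolT cx] := clear_denominators (val x)^-1.
pose y0 : OK K := Sub (iota c * (val x)^-1) cx.
have ec : y0 * x = Z2_to_O c.
  by apply: val_inj; rewrite rmorphM /= mulfVK.
have [j [b cE]] := Z2_factor c0; have [y xE] := xdiv j.+1.
have [w we] := OK_odd_unit b.
have e2 : 2 * (y0 * y) = Z2_to_O (1 + 2 * b).
  apply: (@OK_mulIX2 j); rewrite mulrA -exprSr mulrCA -xE ec cE.
  by rewrite rmorphM rmorphXn rmorph_nat.
by apply: (@OK_2_nonunit (y0 * y * w)); rewrite mulrA e2 mulrC.
Qed.

Lemma val_Z2_sum (I : finType) (x : I -> OK K) (a : I -> Z2adic) :
  val (\sum_i Z2_to_O (a i) * x i) = \sum_i tofrac (a i) *: val (x i).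
Proof.
rewrite raddf_sum; apply: eq_bigr => i _; rewrite -iota_scale.
exact: (rmorphM (val : {rmorphism OK K -> K}) _ (x i)).
Qed.

(** Linear independence over [F_2] of the classes modulo 2. *)
Definition indep2 r (x : 'I_r -> OK K) : Prop :=
  forall c : 'I_r -> bool,
    (exists y, \sum_i (c i)%:R * x i = 2 * y) -> forall i, c i = false.

Definition span2 r (x : 'I_r -> OK K) (y : OK K) : Prop :=
  exists (c : 'I_r -> bool) z, y = \sum_i (c i)%:R * x i + 2 * z.

Lemma sum_bits r (x : 'I_r -> OK K) (a b : 'I_r -> Z2adic) (c : 'I_r -> bool) :
  (forall i, a i = (c i)%:R + 2 * b i) ->
  \sum_i Z2_to_O (a i) * x i =
    \sum_i (c i)%:R * x i + 2 * \sum_i Z2_to_O (b i) * x i.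
Proof.
move=> ab; rewrite mulr_sumr -big_split; apply: eq_bigr => i _ /=.
by rewrite ab rmorphD rmorphM !rmorph_nat mulrDl mulrA.
Qed.

(** Infinite descent: in a relation over Z_2 all the coefficients are even, and
    half of a relation is again one. *)
Lemma indep2_Z2 r (x : 'I_r -> OK K) (a : 'I_r -> Z2adic) :
  indep2 x -> \sum_i Z2_to_O (a i) * x i = 0 -> forall i, a i = 0.
Proof.
move=> ind xa0 i; apply: Z2_separated => m; move: i.
elim: m => [|m IHm] in a xa0 *; first by move=> i; exists (a i); rewrite mul1r.
have [c /boolp.choice[b ab]] := boolp.choice (fun i => Z2_bit (a i)).
move: xa0; rewrite (sum_bits _ ab) => /eqP; rewrite addr_eq0 => /eqP e0.
have c0 : forall i, c i = false.
  by apply: ind; eexists; rewrite e0 -mulrN; reflexivity.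
have xb0 : \sum_i Z2_to_O (b i) * x i = 0.
  apply: OK_mulI2; rewrite mulr0; apply/eqP; rewrite -oppr_eq0 -e0.
  by apply/eqP/big1 => i _; rewrite c0 mul0r.
by move=> i; have [b' e] := IHm b xb0 i; exists b';
  rewrite ab c0 add0r e mulrA exprS.
Qed.

Lemma indep2_free r (x : 'I_r -> OK K) :
  indep2 x -> free [tuple val (x i) | i < r].
Proof.
move=> ind; apply/freeP => k xk0 i.
pose s n := if insub n is Some j then k (j : 'I_r) else 0.
have [b b0 hb] := common_denominator s r.
have /boolp.choice[a ea] j : exists a, tofrac b * k j = tofrac a.
  by have := hb j (ltn_ord j); rewrite /s valK.
have /(indep2_Z2 ind)/(_ i) ai0 : \sum_i Z2_to_O (a i) * x i = 0.
  apply: val_inj; rewrite rmorph0 val_Z2_sum.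
  have := congr1 ( *:%R (tofrac b)) xk0; rewrite scaler0; apply: etrans.
  rewrite scaler_sumr; apply: eq_bigr => j _.
  by rewrite scalerA ea -tnth_nth tnth_mktuple.
have := ea i; rewrite ai0 rmorph0 => /eqP; rewrite mulf_eq0 tofrac_eq0.
by rewrite (negPf b0) => /eqP.
Qed.

Lemma indep2_size r (x : 'I_r -> OK K) : indep2 x -> (r <= \dim {:K})%N.
Proof.
move=> /indep2_free fx; rewrite -[r](size_tuple [tuple val (x i) | i < r]).
by rewrite -(eqP fx) dimvS ?subvf.
Qed.

Lemma indep2_inj r (x : 'I_r -> OK K) (c c' : 'I_r -> bool) y : indep2 x ->
  \sum_i (c i)%:R * x i = \sum_i (c' i)%:R * x i + 2 * y -> c =1 c'.
Proof.
move=> ind /eqP; rewrite addrC -subr_eq -sumrB => /eqP e i.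
(* The exclusive or of two bits is their difference up to an even number. *)
suff /(_ i) : forall i, (c i (+) c' i) = false by case: (c i) (c' i) => -[].
apply: ind; exists (y + \sum_i (~~ c i && c' i)%:R * x i).
rewrite mulrDr -e mulr_sumr -big_split; apply: eq_bigr => l _ /=.
case: (c l) (c' l) => -[]; rewrite /= ?mul1r ?mul0r ?mulr0 ?addr0 ?subrr ?subr0
  //.
by rewrite sub0r mulr_natl mulr2n addKr.
Qed.

Lemma indep2_extend r (x : 'I_r -> OK K) y : indep2 x -> ~ span2 x y ->
  indep2 (fun i : 'I_r.+1 => if unlift ord0 i is Some j then x j else y).
Proof.
move=> ind nsp c [z]; rewrite big_ord_recl unlift_none.
rewrite (eq_bigr (fun i => (c (lift ord0 i))%:R * x i)); last first.
  by move=> i _; rewrite liftK.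
case c0: (c ord0).
  rewrite mul1r => e; case: nsp; exists (fun i => c (lift ord0 i)).
  exists (z - \sum_(i < r) (c (lift ord0 i))%:R * x i).
  rewrite mulrBr -e mulr_natl mulr2n opprD.
  by rewrite addrACA subrr addr0 [RHS]addrC subrK.
rewrite mul0r add0r => e i; case: (unliftP ord0 i) => [j|] -> //.
by apply: (ind (fun i => c (lift ord0 i))); exists z.
Qed.

Lemma indep2_maximal : exists r (x : 'I_r ->
  OK K), indep2 x /\ forall y, span2 x y.
Proof.
suff ext k r (x : 'I_r -> OK K) : indep2 x -> (\dim {:K} - r < k)%N ->
    exists r (x : 'I_r -> OK K), indep2 x /\ forall y, span2 x y.
  by apply: (ext _ 0 (fun=> 0)) (leqnn _) => c _ [].
elim: k => // k IHk in r x * => ind lek.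
have [sp | /existsNP[y nsp]] := pselect (forall y, span2 x y);
  first by exists r, x.
have ind' := indep2_extend ind nsp; apply: (IHk _ _ ind').
by have := indep2_size ind'; lia.
Qed.

(** Successive approximation: the bits of the coefficients are found one at a
    time, and the error, divisible by every power of 2, vanishes. *)
Lemma span2_span r (x : 'I_r -> OK K) : (forall y, span2 x y) ->
  forall y, exists a, y = \sum_i Z2_to_O (a i) * x i.
Proof.
move=> /boolp.choice[c /boolp.choice[z cz]] y.
pose a m i := digits (fun j => c (iter (m + j) z y) i).
exists (a 0); apply/eqP; rewrite -subr_eq0; apply/eqP.
pose D m := iter m z y - \sum_i Z2_to_O (a m i) * x i.
have DS m : D m = 2 * D m.+1.
  have ab i : a m i = (c (iter m z y) i)%:R + 2 * a m.+1 i.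
    rewrite /a digits_rec /= addn0; congr (_ + 2 * digits _).
    by apply: funext => j /=; rewrite addnS ?addSn.
  by rewrite /D {1}(cz (iter m z y)) (sum_bits _ ab) mulrBr opprD addrACA
    subrr add0r.
apply: OK_separated => m; exists (D m); rewrite -[LHS]/(D 0).
by elim: m => [|m ->]; rewrite ?mul1r // {1}DS mulrA exprSr.
Qed.

(** A maximal family independent modulo 2 generates O_K over Z_2 by
    [span2_span], hence K over Q_2, as every element of K has an integral
    multiple; so its length is the degree. *)
Lemma integral_basis : exists x : 'I_(\dim {:K}) -> OK K,
  [/\ basis_of {:K} [tuple val (x i) | i < \dim {:K}],
      indep2 x & forall y, exists a, y = \sum_i Z2_to_O (a i) * x i].
Proof.
have [r [x [ind /span2_span sp]]] := indep2_maximal.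
have bx : basis_of {:K} [tuple val (x i) | i < r].
  rewrite /basis_of indep2_free // andbT eqEsubv subvf; apply/subvP => z _.
  have [c c0 /asboolT cz] := clear_denominators z.
  have [a ea] := sp (Sub (iota c * z) cz).
  have -> : z = (tofrac c)^-1 *: (iota c * z).
    by rewrite iota_scale scalerA mulVf ?scale1r // tofrac_eq0.
  rewrite rpredZ //.
  have -> : iota c * z = val (Sub (iota c * z) cz : OK K) by [].
  rewrite ea val_Z2_sum rpred_sum // => i _.
  rewrite rpredZ // memv_span //; apply/mapP; exists i => //.
  by rewrite mem_enum.
have er : r = \dim {:K} by rewrite -(size_basis bx).
by case: _ / er in x ind sp bx *; exists x.
Qed.

End Integers.

(** * The residue field and the trace *)

Section Residue.
Variable K : fieldExtType Q2adic.
Variable hK : unramified K.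

(** The ideal takes [hK] as an argument so that the field structure of its
    quotient can depend on it. *)
Definition max_ideal (_ : unramified K) : {pred OK K} := @mK K.

Fact max_ideal_closed : idealr_closed (max_ideal hK).
Proof.
split; first by apply/asboolP; exists 0; rewrite mulr0.
  by apply/asboolP => -[y /esym/OK_2_nonunit].
move=> a _ _ /asboolP[y ->] /asboolP[z ->]; apply/asboolP.
by exists (a * y + z); rewrite mulrDr mulrCA.
Qed.
HB.instance Definition _ := isIdealr.Build (OK K) (max_ideal hK)
  max_ideal_closed.

Definition residue : Type := {ideal_quot (max_ideal hK)}.
HB.instance Definition _ := GRing.ComNzRing.on residue.

Definition red (x : OK K) : residue := \pi_({ideal_quot (max_ideal hK)})%qT x.

Fact red_zmod_morphism : zmod_morphism red.
Proof. exact: raddfB (\pi_({ideal_quot (max_ideal hK)}))%qT. Qed.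
Fact red_monoid_morphism : monoid_morphism red.
Proof.
split; first exact: (rmorph1 (\pi_({ideal_quot (max_ideal hK)}))%qT).
exact: (rmorphM (\pi_({ideal_quot (max_ideal hK)}))%qT).
Qed.
HB.instance Definition _ :=
  GRing.isZmodMorphism.Build _ _ red red_zmod_morphism.
HB.instance Definition _ :=
  GRing.isMonoidMorphism.Build _ _ red red_monoid_morphism.

Lemma red_eq0 x : red x = 0 <-> exists y, x = 2 * y.
Proof.
rewrite -(rmorph0 red); split.
  by move=> /eqP; rewrite -[_ == _]Quotient.idealrBE subr0 => /asboolP.
by move=> e; apply/eqP; rewrite -[_ == _]Quotient.idealrBE subr0; apply/asboolP.
Qed.

Lemma red_surj (z : residue) : exists x, z = red x.
Proof. by exists (repr z); rewrite /red reprK. Qed.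

Definition residue_inv (z : residue) : residue := xget 0 [set y | y * z = 1].

Fact residue_mulVr z : z != 0 -> residue_inv z * z = 1.
Proof.
have [x ->] := red_surj z => /eqP x0.
have [y yx] : exists y, y * x = 1.
  by apply: contrapT => /hK/asboolP/red_eq0.
apply: (@xgetI _ 0 [set y | y * red x = 1] (red y)).
by rewrite /= -rmorphM yx rmorph1.
Qed.

Fact residue_inv0 : residue_inv 0 = 0.
Proof.
apply: xgetPN => y /=; rewrite mulr0 => /esym/eqP.
by rewrite oner_eq0.
Qed.

HB.instance Definition _ :=
  GRing.ComNzRing_isField.Build residue residue_mulVr residue_inv0.

Local Notation d := (\dim {:K}).
Local Notation k := residue.

Lemma residue_pchar : 2%N \in [pchar k].
Proof.
rewrite inE /= -(rmorph_nat red); apply/eqP/red_eq0.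
by exists 1; rewrite mulr1.
Qed.

Lemma residue_pow2 j : [pchar k].-nat (2 ^ j)%N.
Proof.
rewrite pnatX; apply/orP; left.
by rewrite pnatE // residue_pchar.
Qed.

Lemma sum_pow2 (I : finType) (F : I -> k) j :
  (\sum_i F i) ^+ (2 ^ j) = \sum_i F i ^+ (2 ^ j).
Proof.
apply: (big_morph (fun x : k => x ^+ (2 ^ j))).
  by move=> x y; apply: exprDn_pchar; apply: residue_pow2.
by rewrite expr0n expn_eq0.
Qed.

Lemma bool_pow2 (c : bool) j : (c%:R : k) ^+ (2 ^ j) = c%:R.
Proof. by case: c; rewrite ?expr1n // expr0n expn_eq0. Qed.

Variables (x : 'I_d -> OK K) (ind : indep2 x).

(** The [2 ^ d] combinations of the [x i] modulo 2 are roots of the polynomial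
    of the [u j * 'X ^ (2 ^ j)], whose degree is smaller than [2 ^ d]. *)
Lemma moore_independent (u : 'I_d -> k) :
  (forall i, \sum_j u j * red (x i) ^+ (2 ^ j) = 0) -> forall j, u j = 0.
Proof.
move=> u0; pose p := \sum_j u j *: 'X^(2 ^ j).
have pE i : p`_i = \sum_j u j * (i == 2 ^ j :> nat)%N%:R.
  by rewrite coef_sum; apply: eq_bigr => j _; rewrite coefZ coefXn.
suff p0 : p = 0.
  move=> j; have := pE (2 ^ j)%N; rewrite p0 coef0 (bigD1 j) //= eqxx mulr1.
  rewrite big1 ?addr0 // => l lj; rewrite eqn_exp2l // eq_sym.
  by rewrite (inj_eq val_inj) (negPf lj) mulr0.
apply/eqP/negP => /negP p0.
pose E (c : {ffun 'I_d -> bool}) := red (\sum_i (c i)%:R * x i).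
have Einj : injective E.
  move=> c c' /eqP; rewrite -subr_eq0 -rmorphB => /eqP/red_eq0[y /eqP].
  by rewrite subr_eq addrC => /eqP/(indep2_inj ind) e; apply/ffunP.
have rts : all (root p) (codom E).
  apply/allP => _ /codomP[c ->]; apply/rootP; rewrite /p horner_sum.
  transitivity (\sum_i (c i)%:R * \sum_j u j * red (x i) ^+ (2 ^ j)).
    under [RHS]eq_bigr do rewrite mulr_sumr.
    rewrite exchange_big; apply: eq_bigr => j _ /=.
    rewrite hornerZ hornerXn /E rmorph_sum sum_pow2 mulr_sumr.
    apply: eq_bigr => i _; rewrite rmorphM rmorph_nat exprMn bool_pow2.
    by rewrite mulrCA.
  by rewrite big1 // => i _; rewrite u0 mulr0.
have := max_poly_roots p0 rts.
rewrite (map_inj_uniq Einj) enum_uniq size_codom card_ffun card_bool card_ord.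
move=> /(_ isT); apply/negP; rewrite -leqNgt.
apply/leq_sizeP => i lei; rewrite pE big1 // => j _.
rewrite gtn_eqF ?mulr0 // (leq_trans _ lei) // ltn_exp2l //.
Qed.

(** On [O_K / 2 O_K] the trace of the multiplication by [y] is the sum of the
    conjugates of [y]: the Moore matrix of a basis conjugates the
    multiplication matrix, whose entries in F_2 are fixed by the Frobenius map,
    into the diagonal matrix of the conjugates. *)
Lemma red_trace (y : OK K) (A : 'M[Z2adic]_d) :
  (forall i, y * x i = \sum_j Z2_to_O K (A i j) * x j) ->
  red (Z2_to_O K (\tr A)) = \sum_(j < d) red y ^+ (2 ^ j).
Proof.
move=> yA.
pose B := \matrix_(i, j) red (Z2_to_O K (A i j)) : 'M_d.
pose P := \matrix_(i < d, j < d) red (x i) ^+ (2 ^ j).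
pose D : 'rV_d := \row_j red y ^+ (2 ^ j).
have BP : B *m P = P *m diag_mx D.
  apply/matrixP => i j; rewrite mul_mx_diag !mxE -exprMn -rmorphM mulrC yA.
  rewrite rmorph_sum sum_pow2; apply: eq_bigr => l _; rewrite !mxE.
  rewrite rmorphM exprMn; congr (_ * _).
  have [c [b ->]] := Z2_bit (A i l).
  have e : red (Z2_to_O K (c%:R + 2 * b)) = c%:R.
    rewrite rmorphD rmorphM !rmorph_nat rmorphD rmorphM !rmorph_nat.
    by rewrite (pcharf0 residue_pchar) mul0r addr0.
  by rewrite -[X in _ = X ^+ _]/(red (Z2_to_O K (c%:R + 2 * b))) e bool_pow2.
have detP : \det P != 0.
  rewrite -det_tr; apply/det0P => -[v /eqP v0 vP]; apply: v0.
  apply/rowP => j0; rewrite mxE; apply: moore_independent j0 => i.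
  have := congr1 (fun M : 'rV_d => M 0 i) vP; rewrite !mxE; apply: etrans.
  by apply: eq_bigr => j _; rewrite !mxE.
transitivity (\tr B).
  by rewrite !rmorph_sum; apply: eq_bigr => i _; rewrite mxE.
transitivity (\tr (diag_mx D)); last by rewrite mxtrace_diag;
  apply: eq_bigr => i _; rewrite mxE.
apply: (mulfI detP); have := congr1 (fun M => \tr (M *m \adj P)) BP.
rewrite -mulmxA mul_mx_adj mul_mx_scalar mxtraceZ => ->.
by rewrite mxtrace_mulC mulmxA mul_adj_mx mul_scalar_mx mxtraceZ.
Qed.

End Residue.

Section TraceR.
Variable K : fieldExtType Q2adic.
Local Notation d := (\dim {:K}).

Lemma trK_basis (e : d.-tuple K) (be : basis_of {:K} e) (x : K) :
  trK x = \sum_i coord e i (x * e`_i).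
Proof.
have be0 := vbasisP {:K}.
have -> : trK x = \tr (passmx.mxof e e (amull x)).
  rewrite /trK -[amull x in LHS]comp_lfun1l (passmx.mxof_comp _ _ be).
  rewrite mxtrace_mulC -(passmx.mxof_comp _ _ be0).
  by rewrite comp_lfun1r.
by apply: eq_bigr => i _; rewrite !mxE /= passmx.vecof_delta lfunE.
Qed.

Lemma trK_linear : linear (@trK K : K -> Q2adic^o).
Proof.
move=> a x y; rewrite /trK.
have -> : amull (a *: x + y) = a *: amull x + amull y by exact: amull_is_linear.
by rewrite passmx.mxof_linear mxtraceD mxtraceZ.
Qed.
HB.instance Definition _ :=
  GRing.isLinear.Build Q2adic K Q2adic^o _ (@trK K) trK_linear.

Hypothesis hK : unramified K.

(** If all traces were even, the sum of the conjugates would vanish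
    identically, which the independence of the powers of the Frobenius map
    excludes. *)
Lemma integral_trace : exists T : OK K -> Z2adic,
  (forall y, tofrac (T y) = trK (val y)) /\
  exists y, Z2mod 0 (T y) != 0.
Proof.
have [x [be ind sp]] := integral_basis hK.
have /boolp.choice[A yA] (y : OK K) : exists A : 'M[Z2adic]_d,
    forall i, y * x i = \sum_j Z2_to_O K (A i j) * x j.
  have [a ea] := boolp.choice (fun i => sp (y * x i)).
  exists (\matrix_(i, j) a i j) => i.
  by rewrite ea; apply: eq_bigr => j _; rewrite mxE.
exists (fun y => \tr (A y)); split=> [y|].
  rewrite (trK_basis be) rmorph_sum; apply: eq_bigr => i _.
  rewrite -tnth_nth tnth_mktuple.
  have -> : val y * val (x i) = \sum_j tofrac (A y i j) *: val (x j).
    by rewrite -val_Z2_sum -yA rmorphM.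
  rewrite -[LHS](coord_sum_free (fun j => tofrac (A y i j)) i (basis_free be)).
  congr (coord _ _ _); apply: eq_bigr => j _.
  by rewrite -tnth_nth tnth_mktuple.
apply: contrapT => /forallNP ev.
have d0 : (0 < d)%N by apply: adim_gt0.
suff /eqP : 1 = 0 :> residue hK by rewrite oner_eq0.
apply: (moore_independent ind (u := fun=> 1) _ (Ordinal d0)) => i.
under eq_bigr do rewrite mul1r.
rewrite -(red_trace hK ind (yA (x i))).
have /negP := ev (x i); rewrite negbK => /eqP/Z2_even[b ->].
by apply/red_eq0; exists (Z2_to_O K b); rewrite rmorphM rmorph_nat.
Qed.

Local Notation piR := (\pi_({ideal_quot (@mK2 K)})%qT : OK K -> RK K).

Lemma piR_eq (x y : OK K) : piR x = piR y <-> exists z, x = y + 4 * z.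
Proof.
split.
  move=> /eqP; rewrite -[_ == _]Quotient.idealrBE => /asboolP[z xy].
  by exists z; rewrite -xy addrC subrK.
move=> [z ->]; apply/eqP; rewrite -[_ == _]Quotient.idealrBE.
by apply/asboolP; exists z; rewrite addrC addKr.
Qed.

Lemma piR_surj (z : RK K) : exists x, z = piR x.
Proof. by exists (repr z); rewrite reprK. Qed.

(** The trace maps [4 O_K] to [4 Z_2], so [trR] can be computed on any lift. *)
Lemma trR_additive_odd : (forall z w : RK K, trR (z + w) = trR z + trR w) /\
  exists z : RK K, odd (trR z).
Proof.
have [T [TE [y Ty]]] := integral_trace.
have TB x z : T (x + z) = T x + T z.
  by apply/eqP; rewrite -tofrac_eq tofracD !TE (raddfD val) (linearD (@trK K)).
have T4 x : Z2mod 1 (T (4 * x)) = 0.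
  have -> : 4 * x = x + x + x + x by rewrite mulr_natl !mulrSr add0r.
  rewrite !TB !rmorphD /=; move: (Z2mod 1 (T x)).
  by case=> -[|[|[|[|m]]]] h; apply: val_inj.
have trRE (x : OK K) : trR (piR x) = Z2mod 1 (T x).
  rewrite /trR -TE; set a0 := T _.
  have -> : xget 0 [set a | tofrac a = tofrac a0] = a0.
    by apply: xget_unique => // b /eqP; rewrite tofrac_eq => /eqP.
  have [z zE] : exists z, repr (piR x) = x + 4 * z by apply/piR_eq;
    rewrite reprK.
  by rewrite /a0 zE TB rmorphD /= T4 addr0.
split=> [z w|]; last first.
  have odd_mod (u v : nat) : u = v %[mod 2 ^ 1] -> odd u = odd v.
    by rewrite expn1 !modn2; do 2!case: odd.
  have odd_Z2 (u : 'Z_2) : u != 0 -> odd u by case: u => -[|[|u]].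
  exists (piR y); rewrite trRE (odd_mod _ _ (Z2mod_le (T y) (leq0n 1))).
  exact: odd_Z2.
have [x ->] := piR_surj z; have [x' ->] := piR_surj w.
by rewrite -rmorphD !trRE TB rmorphD.
Qed.

End TraceR.

(** * The character and the quotient ring *)

Section Character.
Variable Rr : realType.

Lemma expiD (s t : Rr) : expi (s + t) = expi s * expi t.
Proof. by rewrite /expi cosD sinD; simpc; congr (_ +i* _)%C; rewrite addrC. Qed.

Definition iexp (n : nat) : Rr[i] := expi (2 * pi / 4 * n%:R).

Lemma iexpD m n : iexp (m + n) = iexp m * iexp n.
Proof. by rewrite /iexp natrD mulrDr expiD. Qed.

Lemma iexp2 : iexp 2 = -1.
Proof.
rewrite /iexp; have -> : 2 * pi / 4 * 2 = pi :> Rr by field.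
by rewrite /expi cospi sinpi; apply/eqP; rewrite eq_complex /= oppr0 !eqxx.
Qed.

Lemma iexp_double n : iexp (n + n) = (-1) ^+ n.
Proof.
elim: n => [|n IHn]; last by rewrite addSnnS -[n.+2]add2n addnCA iexpD IHn
  iexp2 exprS.
rewrite /iexp mulr0 /expi cos0 sin0.
by apply/eqP; rewrite eq_complex /= !eqxx.
Qed.

Lemma iexp_mod4 n : iexp (n %% 4) = iexp n.
Proof.
rewrite [in RHS](divn_eq n 4) iexpD.
elim: (n %/ 4)%N => [|q IHq]; last first.
  by rewrite mulSn (iexpD 4) (iexpD 2 2) iexp2 mulrNN !mul1r.
by rewrite mul0n (iexp_double 0) mul1r.
Qed.

Variable K : fieldExtType Q2adic.
Hypothesis hK : unramified K.

Lemma psiK_D (z w : RK K) : psiK Rr (z + w) = psiK Rr z * psiK Rr w.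
Proof.
rewrite /psiK -!/(iexp _) -iexpD -[RHS]iexp_mod4.
by have [-> _] := trR_additive_odd hK.
Qed.

Lemma psiK_0 : psiK Rr (0 : RK K) = 1.
Proof.
have [tD _] := trR_additive_odd hK.
have t0 : trR (0 : RK K) = 0 by apply: (addrI (trR (0 : RK K)));
  have := tD 0 0; rewrite !addr0.
by rewrite /psiK -/(iexp _) t0 (iexp_double 0).
Qed.

Lemma psiK_nontrivial : exists t : RK K, psiK Rr (2 * t) != 1.
Proof.
have [tD [z odd_z]] := trR_additive_odd hK; exists z.
rewrite mulr_natl mulr2n psiK_D /psiK -!/(iexp _) -iexpD iexp_double.
by rewrite -signr_odd odd_z expr1 eq_sym -addr_eq0 -(natrD _ 1 1) pnatr_eq0.
Qed.

End Character.

Lemma enum_surj (F : finType) (T : choiceType) (f : F -> T) :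
  (forall y, exists x, y = f x) -> exists N (e : 'I_N -> T), bijective e.
Proof.
move=> fs; pose s := undup (codom f).
have ms y : y \in s by rewrite mem_undup; have [x ->] := fs y; apply: codom_f.
have ix y : (index y s < size s)%N by rewrite index_mem.
exists (size s), (tnth (in_tuple s)); exists (fun y => Ordinal (ix y)).
  move=> i; apply: val_inj.
  by rewrite /= (tnth_nth (tnth (in_tuple s) i)) index_uniq ?undup_uniq.
by move=> y; rewrite (tnth_nth y) /= nth_index.
Qed.

Lemma enum_prod (S T : choiceType) m n (e : 'I_m -> S) (f : 'I_n -> T) :
  bijective e -> bijective f ->
  exists N (g : 'I_N -> (S * T)%type), bijective g.
Proof.
move=> [e' eK e'K] [f' fK f'K].
apply: (enum_surj (f := fun ij => (e ij.1, f ij.2))) => -[x y].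
by exists (e' x, f' y); rewrite e'K f'K.
Qed.

Section QuotientRing.
Variable K : fieldExtType Q2adic.
Hypothesis hK : unramified K.
Local Notation d := (\dim {:K}).

Lemma RK_mul2_eq0 (r : RK K) : 2 * r = 0 -> exists s, r = 2 * s.
Proof.
have [x ->] := piR_surj r; rewrite -(rmorph_nat (\pi_(RK K))%qT) -rmorphM.
rewrite -(rmorph0 (\pi_(RK K))%qT) => /piR_eq[z].
rewrite add0r => e; have {e}/OK_mulI2-> : 2 * x = 2 * (2 * z).
  by rewrite e mulrA -natrM.
by exists (\pi_(RK K)%qT z); rewrite rmorphM rmorph_nat.
Qed.

Lemma RK_local (r : RK K) : (exists s, s * r = 1) \/ (exists s, r = 2 * s).
Proof.
have [x ->] := piR_surj r.
have [[y yx] | /hK/asboolP[y ->]] := pselect (exists y, y * x = 1);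
  [left|right].
  by exists (\pi_(RK K)%qT y); rewrite -rmorphM yx rmorph1.
by exists (\pi_(RK K)%qT y); rewrite rmorphM rmorph_nat.
Qed.

Lemma RK_basis : exists x : 'I_d -> RK K,
  (forall r, exists (c : 'I_d -> bool) s, r = \sum_i (c i)%:R * x i + 2 * s) /\
  (forall (c c' : 'I_d -> bool) s,
    \sum_i (c i)%:R * x i = \sum_i (c' i)%:R * x i + 2 * s -> c =1 c').
Proof.
have [x [_ ind sp]] := integral_basis hK.
exists (fun i => \pi_(RK K)%qT (x i)).
have piS (c : 'I_d -> bool) : \sum_i (c i)%:R * \pi_(RK K)%qT (x i) =
  \pi_(RK K)%qT (\sum_i (c i)%:R * x i).
  by rewrite rmorph_sum; apply: eq_bigr => i _; rewrite rmorphM rmorph_nat.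
split=> [r | c c' s].
  have [y ->] := piR_surj r; have [a ->] := sp y.
  have /boolp.choice[c /boolp.choice[b ab]] i := Z2_bit (a i).
  exists c, (\pi_(RK K)%qT (\sum_i Z2_to_O K (b i) * x i)).
  by rewrite (sum_bits _ ab) piS rmorphD rmorphM rmorph_nat.
have [y ->] := piR_surj s; rewrite !piS -(rmorph_nat (\pi_(RK K))%qT 2).
rewrite -rmorphM -rmorphD => /piR_eq[z e] i.
by apply: (indep2_inj ind (y := y + 2 * z)); rewrite mulrDr addrA mulrA
  -natrM e.
Qed.

Lemma RK_finite : exists N (e : 'I_N -> RK K), bijective e.
Proof.
have [x [sp _]] := RK_basis.
pose S (c : {ffun 'I_d -> bool}) := \sum_i (c i)%:R * x i.
apply: (enum_surj (f := fun cc : {ffun 'I_d -> bool} * {ffun 'I_d ->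
  bool} => S cc.1 + 2 * S cc.2)).
have spS r : exists c s, r = S c + 2 * s.
  have [c [s ->]] := sp r; exists [ffun i => c i], s; congr (_ + _).
  by apply: eq_bigr => i _; rewrite ffunE.
move=> r; have [c [s ->]] := spS r; have [c' [s' ->]] := spS s; exists (c, c').
by rewrite mulrDr mulrA -natrM RK4 mul0r addr0.
Qed.

End QuotientRing.

Section Modules.
Import VectorInternalTheory.
Variables (R : comNzRingType) (W : vectType R).
Local Notation D := (dim W).

Lemma vect_ker2 (v : W) : (forall r : R, 2 * r = 0 -> exists s, r = 2 * s) ->
  2 *: v = 0 -> exists w, v = 2 *: w.
Proof.
move=> ker2 v0; have /boolp.choice[b vb] j : exists s, v2r v 0 j = 2 * s.
  apply: ker2; have := congr1 v2r v0.
  by rewrite linearZ linear0 => /rowP/(_ j); rewrite !mxE.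
exists (r2v (\row_j b j)); apply: v2r_inj; rewrite linearZ /= r2vK.
by apply/rowP => j; rewrite !mxE vb.
Qed.

Lemma mod2_enum d (x : 'I_d -> R) :
  (forall r, exists (c : 'I_d -> bool) s, r = \sum_i (c i)%:R * x i + 2 * s) ->
  (forall (c c' : 'I_d -> bool) s,
    \sum_i (c i)%:R * x i = \sum_i (c' i)%:R * x i + 2 * s -> c =1 c') ->
  exists e : 'I_(2 ^ (d * D)) -> mod2 W, bijective e.
Proof.
move=> sp inj; pose I := {ffun 'I_d * 'I_D -> bool}.
have -> : (2 ^ (d * D))%N = #|I|.
  by rewrite card_ffun card_prod !card_ord card_bool.
pose f (c : I) : mod2 W := pi2 (r2v (\row_j \sum_i (c (i, j))%:R * x i)).
have injf : injective f.
  move=> c c' /pi2P[u /(congr1 v2r)].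
  rewrite linearD linearZ /= !r2vK => /rowP e.
  by apply/ffunP => -[i j]; have := e j; rewrite !mxE => /inj/(_ i).
have /boolp.choice[g gK] v : exists c, v = f c.
  rewrite -[v]repr2K; set w := repr2 v.
  have /boolp.choice[c /boolp.choice[s cs]] := fun j => sp (v2r w 0 j).
  exists [ffun ij => c ij.2 ij.1]; apply/pi2P; exists (r2v (\row_j s j)).
  apply: v2r_inj; rewrite linearD linearZ /= !r2vK.
  apply/rowP => j; rewrite !mxE cs; congr (_ + _).
  by apply: eq_bigr => i _; rewrite ffunE.
exists (f \o enum_val); exists (enum_rank \o g).
  move=> i /=; rewrite -[RHS]enum_valK; congr enum_rank.
  by apply: injf; rewrite -gK.
by move=> v /=; rewrite enum_rankK -gK.
Qed.

End Modules.

(** * The ring Z[i, 1/2] *)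

Section Dyadic.
Variable C : numClosedFieldType.
Implicit Types (x y z u : C) (m : nat).

Definition gaussian z := exists a b : int, z = a%:~R + 'i * b%:~R.

Lemma gaussianD y z : gaussian y -> gaussian z -> gaussian (y + z).
Proof.
move=> [a [b ->]] [a' [b' ->]]; exists (a + a'), (b + b').
by rewrite !intrD mulrDr addrACA.
Qed.

Lemma gaussianM y z : gaussian y -> gaussian z -> gaussian (y * z).
Proof.
move=> [a [b ->]] [a' [b' ->]]; exists (a * a' - b * b'), (a * b' + b * a').
have i2 := sqrCi C.
rewrite !(intrD, rmorphN, intrM) /=.
ring: i2.
Qed.

Lemma gaussian_int (a : int) : gaussian a%:~R.
Proof. by exists a, 0; rewrite mulr0 addr0. Qed.

Lemma gaussian_i : gaussian 'i.
Proof. by exists 0, 1; rewrite mulr1 add0r. Qed.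

Lemma gaussian1i : gaussian (1 + 'i).
Proof. exact: gaussianD (gaussian_int 1) gaussian_i. Qed.

Lemma gaussianX z m : gaussian z -> gaussian (z ^+ m).
Proof.
move=> gz; elim: m => [|m IHm]; first exact: (gaussian_int 1).
by rewrite exprS; apply: gaussianM.
Qed.

Lemma norm1i : `|1 + 'i : C| ^+ 2 = 2.
Proof.
have := @normC2_rect C 1 1; rewrite mulr1 => ->; rewrite ?real1 //.
by rewrite expr1n.
Qed.

Lemma onei_neq0 : 1 + 'i != 0 :> C.
Proof. by rewrite -normr_eq0 -sqrf_eq0 norm1i pnatr_eq0. Qed.

Lemma gaussian_normsq (a b : int) :
  `|a%:~R + 'i * b%:~R : C| ^+ 2 = (a ^+ 2 + b ^+ 2)%:~R.
Proof. by rewrite normC2_rect ?realz // intrD !rmorphXn. Qed.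

Lemma pow2_int m : 2 ^+ m = (2 ^+ m : int)%:~R :> C.
Proof. by rewrite rmorphXn. Qed.

(** [1 + 'i] is, up to units, the only prime of norm a power of 2; the fourth
    power removes the units. *)
Lemma gaussian_norm_exp2 z m : gaussian z -> `|z| ^+ 2 = 2 ^+ m ->
  z ^+ 4 = (1 + 'i) ^+ (4 * m).
Proof.
elim: m z => [|m IHm] z [a [b ->]]; rewrite gaussian_normsq pow2_int => /eqP.
  rewrite eqr_int muln0 !expr0 => /eqP ab1.
  have : (a == 0) && (b ^+ 2 == 1) || (b == 0) && (a ^+ 2 == 1) by nia.
  case/orP=> /andP[/eqP-> /eqP e].
    rewrite add0r exprMn -rmorphXn /= (exprM b 2 2) e expr1n mulr1.
    by rewrite (exprM 'i 2 2) sqrCi sqrrN expr1n.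
  by rewrite mulr0 addr0 -rmorphXn /= (exprM a 2 2) e.
rewrite eqr_int [2 ^+ m.+1]exprS => /eqP e.
have [s bE] : exists s, b = 2 * s - a.
  have [s [abs|abs]] : exists s, a + b = 2 * s \/ a + b = 2 * s + 1.
  - by exists ((a + b) %/ 2)%Z; lia.
  - by exists s; rewrite -abs addrC addKr.
  - exfalso; move: e; have -> : b = 2 * s + 1 - a by rewrite -abs addrC addKr.
    move: (2 ^+ m : int) => p; rewrite !expr2 => e; lia.
pose w : C := s%:~R + 'i * (s - a)%:~R.
have zE : a%:~R + 'i * b%:~R = (1 + 'i) * w.
  have i2 := sqrCi C.
  rewrite /w bE !(intrB, intrM); ring: i2.
have nw : `|w| ^+ 2 = 2 ^+ m.
  rewrite gaussian_normsq pow2_int; congr _%:~R.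
  by move: e; rewrite bE; move: (2 ^+ m : int) => p; rewrite !expr2; lia.
rewrite zE exprMn (IHm w) //; last by exists s, (s - a).
by rewrite -exprD mulnS.
Qed.

(** Inverting [1 + 'i] is the same as inverting 2, the square of [1 + 'i] up to
    a unit. *)
Definition dyadic u := exists m, gaussian (u * (1 + 'i) ^+ m).

Lemma dyadic_gaussian z : gaussian z -> dyadic z.
Proof. by exists 0; rewrite mulr1. Qed.

Lemma dyadicD x y : dyadic x -> dyadic y -> dyadic (x + y).
Proof.
move=> [m gx] [m' gy]; exists (m + m')%N; rewrite mulrDl; apply: gaussianD.
  by rewrite exprD mulrA; apply: gaussianM => //; apply/gaussianX/gaussian1i.
rewrite addnC exprD mulrA; apply: gaussianM => //.
exact/gaussianX/gaussian1i.
Qed.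

Lemma dyadicM x y : dyadic x -> dyadic y -> dyadic (x * y).
Proof.
move=> [m gx] [m' gy]; exists (m + m')%N; rewrite exprD mulrACA.
exact: gaussianM.
Qed.

Lemma dyadic_nat n : dyadic n%:R.
Proof. exact/dyadic_gaussian/(gaussian_int n). Qed.

Lemma dyadic_sum (I : finType) (F : I -> C) :
  (forall i, dyadic (F i)) -> dyadic (\sum_i F i).
Proof.
move=> dF; apply: (big_ind dyadic) => //; first exact: (dyadic_nat 0).
exact: dyadicD.
Qed.

Lemma dyadic_inv1i m : dyadic ((1 + 'i) ^- m).
Proof.
exists m; rewrite mulVf ?expf_neq0 ?onei_neq0 //.
exact: (gaussian_int 1).
Qed.

Lemma dyadic_root4 u : u ^+ 4 = 1 -> dyadic u.
Proof.
move=> /eqP; rewrite -subr_eq0.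
have -> : u ^+ 4 - 1 = (u - 1) * (u + 1) * (u - 'i) * (u + 'i).
  by have i2 := sqrCi C; ring: i2.
rewrite !mulf_eq0 !subr_eq0 !addr_eq0 => /orP[/orP[/orP[]|]|] /eqP ->;
  apply: dyadic_gaussian.
- exact: (gaussian_int 1).
- exact: (gaussian_int (-1)).
- exact: gaussian_i.
- by exists 0, (-1); rewrite add0r mulrN1.
Qed.

(** Multiplied by a power of [1 + 'i], such an element becomes a Gaussian
    integer whose norm is a power of 2. *)
Lemma dyadic_norm1 u : dyadic u -> `|u| = 1 -> u ^+ 4 = 1.
Proof.
move=> [m gu] u1; have := gaussian_norm_exp2 gu (m := m).
rewrite normrM u1 mul1r normrX -exprM mulnC exprM norm1i => /(_ erefl).
rewrite exprMn -exprM [(m * 4)%N]mulnC -[RHS]mul1r.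
by move=> /mulIf -> //; rewrite expf_neq0 ?onei_neq0.
Qed.

Lemma onei_exp4 : (1 + 'i : C) ^+ 4 = - 4.
Proof. by have i2 := sqrCi C; ring: i2. Qed.

End Dyadic.

(** * Sums over finite types given by an enumeration *)

Section Tsum.
Variables (T : choiceType) (N : nat) (e : 'I_N -> T) (e_bij : bijective e).
Variable C : numClosedFieldType.
Implicit Types (F : T -> C) (A : set T).

(** The types summed over are finite only by hypothesis, so sums run along a
    given enumeration, and subsets enter through their indicators. *)
Definition tsum F : C := \sum_i F (e i).
Definition ind A (x : T) : C := (`[< A x >])%:R.

Lemma tsum_bij (s : T -> T) F : bijective s -> tsum (F \o s) = tsum F.
Proof.
case: e_bij => e' eK e'K [s' sK s'K]; rewrite /tsum.
rewrite [RHS](reindex (e' \o s \o e)) /=.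
  by apply: eq_bigr => i _; rewrite e'K.
exists (e' \o s' \o e) => i _ /=; first by rewrite e'K sK eK.
by rewrite e'K s'K eK.
Qed.

Lemma eq_tsum F G : (forall x, F x = G x) -> tsum F = tsum G.
Proof. by move=> FG; apply: eq_bigr => i _. Qed.

Lemma tsumZ c F : tsum (fun x => c * F x) = c * tsum F.
Proof. by rewrite /tsum mulr_sumr. Qed.

Lemma tsum1 F x : (forall y, y != x -> F y = 0) -> tsum F = F x.
Proof.
case: e_bij => e' eK e'K F0; rewrite /tsum (bigD1 (e' x)) //= e'K big1 ?addr0
  //.
move=> i ix; apply: F0; apply: contra_neq ix => <-; exact: esym (eK i).
Qed.

Lemma tsum_ind A : tsum (ind A) = (#|[pred i | `[< A (e i) >]]|)%:R.
Proof.
rewrite /tsum -sum1_card natr_sum [RHS]big_mkcond; apply: eq_bigr => i _ /=.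
by rewrite inE /ind; case: asboolP.
Qed.

Lemma ind_in A x : A x -> ind A x = 1.
Proof. by move=> Ax; rewrite /ind asboolT. Qed.

Lemma ind_out A x : ~ A x -> ind A x = 0.
Proof. by move=> Ax; rewrite /ind asboolF. Qed.

Lemma tsum_ind_ge1 A x : A x -> 1 <= tsum (ind A).
Proof.
case: e_bij => e' eK e'K Ax; rewrite tsum_ind ler1n; apply/card_gt0P.
by exists (e' x); rewrite unfold_in /= e'K asboolT.
Qed.

Lemma tsum_ind_neq0 A x : A x -> tsum (ind A) != 0.
Proof. by move=> /tsum_ind_ge1 A1; rewrite gt_eqF ?(lt_le_trans ltr01 A1). Qed.

End Tsum.

Lemma exchange_tsum (T U : choiceType) (N P : nat) (e : 'I_N -> T)
    (f : 'I_P -> U) (C : numClosedFieldType) (F : T -> U -> C) :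
  tsum e (fun x => tsum f (F x)) = tsum f (fun y => tsum e (F ^~ y)).
Proof. exact: exchange_big. Qed.

Lemma tsum_fsbig (T : choiceType) (N : nat) (e : 'I_N -> T)
    (e_bij : bijective e) (C : numClosedFieldType) (A : set T) (F : T -> C) :
  \sum_(x \in A) F x = tsum e (fun x => ind C A x * F x).
Proof.
case: (e_bij) => e' eK e'K; rewrite fsbig_mkcond.
have -> : [set: T] = [set` [seq e i | i <- enum 'I_N]].
  apply/seteqP; split=> x // _ /=; apply/mapP; exists (e' x);
    last by rewrite e'K.
  by rewrite mem_enum.
rewrite -fsbig_seq; last by rewrite map_inj_uniq ?enum_uniq //;
  apply: can_inj eK.
rewrite big_map big_enum; apply: eq_bigr => i _; rewrite /patch.
have [Ae|Ae] := pselect (A (e i)); first by rewrite mem_set // ind_in // mul1r.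
by rewrite memNset // ind_out // mul0r.
Qed.

(** * Finite symplectic modules *)

Section Symplectic.
Variables (R : comNzRingType) (V : lmodType R) (b : V -> V -> R).
Variables (C : numClosedFieldType) (psi : R -> C).
Variables (N : nat) (e : 'I_N -> V).
Hypothesis e_bij : bijective e.
Hypothesis bDl : forall u v w, b (u + v) w = b u w + b v w.
Hypothesis bZl : forall r u w, b (r *: u) w = r * b u w.
Hypothesis b_sym : forall u v, b u v = b v u.
Hypothesis b_nondeg : forall v, (forall u, b u v = 0) -> v = 0.
Hypothesis psiD : forall x y, psi (x + y) = psi x * psi y.
Hypothesis psi0 : psi 0 = 1.
Hypothesis psi_nondeg : forall u v, b u v != 0 ->
  exists r, psi (r * b u v) != 1.
Implicit Types (A M L S : set V) (u v w : V).

Local Notation orth := (Defs.orthogonal b).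

Lemma bDr u v w : b u (v + w) = b u v + b u w.
Proof. by rewrite ![b u _]b_sym bDl. Qed.

Lemma submodD A u v : submodule A -> A u -> A v -> A (u + v).
Proof. by move=> [_ sA] Au Av; rewrite -[u]scale1r; apply: sA. Qed.

Lemma submodZ A r u : submodule A -> A u -> A (r *: u).
Proof. by move=> [A0 sA] Au; rewrite -[_ *: _]addr0; apply: sA. Qed.

Lemma submodN A u : submodule A -> A u -> A (- u).
Proof. by move=> sA Au; rewrite -scaleN1r; apply: submodZ. Qed.

Lemma submodB A u v : submodule A -> A u -> A v -> A (u - v).
Proof. by move=> sA Au Av; apply: submodD => //; apply: submodN. Qed.

Lemma orth_submod A : submodule (orth A).
Proof.
split=> [a _|r v w ov ow a Aa]; last first.
  by rewrite bDr b_sym bZl b_sym ov // ow // mulr0 addr0.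
by rewrite b_sym -[0](scale0r 0) bZl mul0r.
Qed.

Lemma submodT : submodule [set: V].
Proof. by []. Qed.

Lemma orthT v : orth setT v -> v = 0.
Proof. by move=> ov; apply: b_nondeg => u; apply: ov. Qed.

Lemma shift_bij w : bijective (fun v : V => v + w).
Proof. by exists (fun v => v - w) => v; rewrite ?addrK ?subrK. Qed.

(** Orthogonality of characters: the sum of a character over a group vanishes
    unless the character is trivial. *)
Lemma sum_character A v : submodule A ->
  tsum e (fun a => ind C A a * psi (b a v)) =
    ind C (orth A) v * tsum e (ind C A).
Proof.
move=> sA; have [ov|nov] := pselect (orth A v).
  rewrite ind_in // mul1r; apply: eq_tsum => a.
  have [Aa|nAa] := pselect (A a); last by rewrite ind_out // mul0r.
  by rewrite ov // psi0 mulr1.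
rewrite (ind_out _ nov) mul0r.
have [a [Aa av]] : exists a, A a /\ b a v != 0.
  apply: contrapT => h; apply: nov => a Aa; apply: contrapT => /eqP av.
  by apply: h; exists a.
have [r /eqP r1] := psi_nondeg av; set S := tsum _ _.
have Sr : S = psi (r * b a v) * S.
  rewrite {1}/S -(tsum_bij e_bij _ (shift_bij (r *: a))) /S -tsumZ.
  apply: eq_tsum => u /=; rewrite bDl bZl psiD mulrA mulrC; congr (_ * (_ * _)).
  congr (nat_of_bool _)%:R; apply/asbool_equiv_eq; split=> Au.
    by rewrite -[u](addrK (r *: a)); apply: submodB => //; apply: submodZ.
  by apply: submodD => //; apply: submodZ.
have /eqP : (1 - psi (r * b a v)) * S = 0 by rewrite mulrBl mul1r -Sr subrr.
by rewrite mulf_eq0 subr_eq0 eq_sym => /orP[/eqP//|/eqP].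
Qed.

Lemma sum_character_full u :
  tsum e (fun w => psi (b w u)) = ind C [set 0] u * N%:R.
Proof.
have indT w : ind C setT w = 1 by apply: ind_in.
have -> : tsum e (fun w => psi (b w u)) =
    tsum e (fun w => ind C setT w * psi (b w u)).
  by apply: eq_tsum => w; rewrite indT mul1r.
rewrite (sum_character _ submodT) tsum_ind; congr ((nat_of_bool _)%:R * _%:R).
  apply/asbool_equiv_eq; split; first exact: orthT.
  by move=> -> w _; rewrite b_sym -(scale0r 0) bZl mul0r.
by rewrite -[RHS]card_ord; apply: eq_card => i; rewrite unfold_in /= asboolT.
Qed.

Lemma sum_set1 (F : V -> C) : tsum e (fun v => ind C [set 0] v * F v) = F 0.
Proof.
rewrite (tsum1 e_bij _ (x := 0)); first by rewrite ind_in // mul1r.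
by move=> y /eqP y0; rewrite ind_out // mul0r.
Qed.

(** For [u] in the double orthogonal, the sum of [psi (b a v) * psi (b v u)]
    over [a] in [A] and all [v] is [#|A| * #|orth A|] when summed over [a]
    first; when summed over [v] first it vanishes unless [u] is in [A]. *)
Lemma orth_orth A : submodule A -> orth (orth A) = A.
Proof.
move=> sA; apply/seteqP; split=> u; last first.
  by move=> Au v ov; rewrite b_sym; apply: ov.
move=> oou; apply: contrapT => nAu.
have N0 : (N%:R : C) != 0.
  rewrite pnatr_eq0 -lt0n; case: e_bij => e' _ _.
  by case: (N) (e' 0) => // -[].
pose X := tsum e (fun v => tsum e (fun a =>
  ind C A a * (psi (b a v) * psi (b v u)))).
have X1 : X = tsum e (ind C (orth A)) * tsum e (ind C A).
  rewrite mulrC -tsumZ; apply: eq_tsum => v.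
  transitivity (psi (b v u) * tsum e (fun a => ind C A a * psi (b a v))).
    by rewrite -tsumZ; apply: eq_tsum => a; rewrite [RHS]mulrCA
      [X in _ = _ * X]mulrC.
  rewrite sum_character //; have [ov|nov] := pselect (orth A v); last first.
    by rewrite ind_out // mulr0 mul0r mulr0.
  by rewrite oou // psi0 mul1r mulrC.
have X0 : X = 0.
  rewrite /X exchange_tsum; apply: etrans (_ : tsum e (fun=> 0) = 0);
    last first.
    by rewrite /tsum big1.
  apply: eq_tsum => a; have [Aa|nAa] := pselect (A a); last first.
    by rewrite /tsum big1 // => i _; rewrite ind_out // mul0r.
  rewrite tsumZ; transitivity (ind C A a * tsum e (fun v => psi (b v (a + u)))).
    by congr (_ * _); apply: eq_tsum => v; rewrite bDr psiD (b_sym a).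
  have au0 : ~ [set 0] (a + u).
    by move=> /= au0; apply: nAu; rewrite -[u](addKr a) au0 addr0;
      apply: submodN.
  by rewrite sum_character_full (ind_out _ au0) mul0r mulr0.
have := tsum_ind_neq0 e_bij C (x := 0) (A := A) (proj1 sA).
have := tsum_ind_neq0 e_bij C (x := 0) (A := orth A) (proj1 (orth_submod A)).
by move=> n1 n2; move/eqP: X1; rewrite X0 eq_sym mulf_eq0 (negPf n1) (negPf n2).
Qed.

(** Double counting of the sum of the [psi (b a v)] over [a] in [A] and all
    [v]. *)
Lemma lagrangian_card A : lagrangian b A -> tsum e (ind C A) ^+ 2 = N%:R.
Proof.
move=> [sA oA].
transitivity (tsum e (fun v => tsum e (fun a => ind C A a * psi (b a v)))).
  rewrite expr2 -tsumZ; apply: eq_tsum => v.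
  by rewrite sum_character // oA mulrC.
rewrite exchange_tsum.
transitivity (tsum e (fun a => ind C [set 0] a * (ind C A a * N%:R))).
  apply: eq_tsum => a; rewrite tsumZ mulrCA -sum_character_full.
  by congr (_ * _); apply: eq_tsum => v; rewrite b_sym.
by rewrite sum_set1 ind_in ?mul1r //; case: sA.
Qed.

Definition sumset A S : set V :=
  [set v | exists2 a, A a & exists2 s, S s & v = a + s].

Lemma sumset_submod A S : submodule A -> submodule S -> submodule (sumset A S).
Proof.
move=> sA sS; split.
  by exists 0; [exact: (proj1 sA)|exists 0; [exact: (proj1 sS)|rewrite addr0]].
move=> r _ _ [a Aa [s Ss ->]] [a' Aa' [s' Ss' ->]].
exists (r *: a + a'); first exact: (proj2 sA).
exists (r *: s + s'); first exact: (proj2 sS).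
by rewrite scalerDr addrACA.
Qed.

(** The orthogonal of the sum lies in [A] and in [M], so it is zero. *)
Lemma sumset_full A M : submodule A -> orth A `<=` A -> lagrangian b M ->
  (forall v, A v -> M v -> v = 0) -> forall v, sumset A M v.
Proof.
move=> sA cA [sM oM] AM0 v.
rewrite -(orth_orth (sumset_submod sA sM)) => w ow.
have -> : w = 0; last by rewrite -(scale0r 0) bZl mul0r.
apply: AM0; last rewrite -oM.
  by apply: cA => a Aa; apply: ow; exists a => //; exists 0; rewrite ?addr0 //;
    case: sM.
by move=> m Mm; apply: ow; exists 0; [case: sA|exists m; rewrite ?add0r].
Qed.

Lemma lagrangian_disjoint A M : lagrangian b A -> lagrangian b M ->
  (forall v, sumset A M v) -> forall v, A v -> M v -> v = 0.
Proof.
move=> [sA oA] [sM oM] AM v Av Mv; apply: b_nondeg => u.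
have [a Aa [m Mm ->]] := AM u; rewrite bDl.
have ov : orth A v by rewrite oA.
have ov' : orth M v by rewrite oM.
by rewrite ov // ov' // addr0.
Qed.

(** If [orth A] were covered by [A + M], any two of its elements would be
    orthogonal, which puts [orth A] inside [orth (orth A)], that is [A]. A
    group is not the union of two proper subgroups, so both sums can be avoided
    at once. *)
Lemma avoid_lagrangians A M L : submodule A -> A `<=` orth A ->
  ~ (orth A `<=` A) -> lagrangian b M -> lagrangian b L ->
  exists v, [/\ orth A v, ~ sumset A M v & ~ sumset A L v].
Proof.
move=> sA iA nA lM lL.
have out S : lagrangian b S -> exists2 v, orth A v & ~ sumset A S v.
  move=> [sS oS]; apply: contrapT => h.
  have cov v : orth A v -> sumset A S v.
    by move=> ov; apply: contrapT => nv; apply: h; exists v.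
  apply: nA => v ov; rewrite -(orth_orth sA) => w ow.
  have [a Aa [s Ss ev]] := cov _ ov; have [a' Aa' [s' Ss' ew]] := cov _ ow.
  have os : orth A s.
    by have -> : s = v - a; [rewrite ev addrC addKr|apply: submodB (orth_submod
      _) _ _ => //; apply: iA].
  have os' : orth A s'.
    by have -> : s' = w - a'; [rewrite ew addrC addKr|apply: submodB
      (orth_submod _) _ _ => //; apply: iA].
  have oSs : orth S s by rewrite oS.
  by rewrite ew bDl ov // add0r ev bDr (b_sym s' a) os' // add0r oSs.
have [x ox nx] := out M lM; have [y oy ny] := out L lL.
have [sM sL] := (sumset_submod sA (proj1 lM), sumset_submod sA (proj1 lL)).
have [xL|nxL] := pselect (sumset A L x); last by exists x.
have [yM|nyM] := pselect (sumset A M y); last by exists y.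
exists (x + y); split; first exact: submodD (orth_submod A) _ _.
  by move=> xyM; apply: nx; rewrite -[x](addrK y); apply: submodB.
by move=> xyL; apply: ny; rewrite -[y](addKr x) addrC; apply: submodB.
Qed.

End Symplectic.

(** * The Heisenberg group *)

Lemma linear_zero (F : nzRingType) (U V : lmodType F) (p : U -> V) :
  linear p -> p 0 = 0.
Proof.
move=> pl; have := pl (-1) 0 0; rewrite scaler0 addr0 => {1}->.
by rewrite scaleN1r addNr.
Qed.

Section Heisenberg.
Variables (R : comNzRingType) (L0 M0 : vectType R).
Local Notation W := (L0 * M0)%type.
Local Notation V := (mod2 W).
Variables (R4 : 4 = 0 :> R) (om : {biscalar W}).
Hypothesis om_symp : symplectic om.
Hypothesis lagL0 : lagrangian om [set x | x.2 = 0].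
Hypothesis lagM0 : lagrangian om [set x | x.1 = 0].
Hypothesis R_local : forall r : R, (exists s, s * r = 1) \/ (exists s, r =
  2 * s).
Hypothesis W_ker2 : forall v : W, 2 *: v = 0 -> exists w, v = 2 *: w.

Local Notation b := (omega om).
Local Notation H := (Heis R4 om).

Lemma mulr22 : 2 * 2 = 0 :> R. Proof. by rewrite -natrM. Qed.

Lemma twoN (x : R) : 2 * - x = 2 * x.
Proof. by apply/eqP; rewrite mulrN eq_sym -addr_eq0 -mulrDl -natrD R4 mul0r.
  Qed.

Lemma om_anti v w : om v w = - om w v.
Proof.
apply/eqP; rewrite -addr_eq0; have := om_symp.1 (v + w).
by rewrite linearDl /= !linearDr /= !om_symp.1 add0r addr0 => ->.
Qed.

Lemma omegaE v w : b (pi2 v) (pi2 w) = 2 * om v w.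
Proof. exact: form2E. Qed.

Lemma mod2_scale2 r (v : V) : (2 * r) *: v = 0.
Proof.
rewrite -[v]repr2K; have -> : (2 * r) *: pi2 (repr2 v) =
  pi2 ((2 * r) *: repr2 v).
  exact: scale2E.
rewrite -(raddf0 (@pi2 _ W)); apply/pi2P.
by exists (r *: repr2 v); rewrite add0r scalerA.
Qed.

Lemma omegaDl u v w : b (u + v) w = b u w + b v w.
Proof. exact: form2Dl. Qed.

Lemma omegaZl r u w : b (r *: u) w = r * b u w.
Proof.
rewrite -[u]repr2K -[w]repr2K; have -> : r *: pi2 (repr2 u) =
  pi2 (r *: repr2 u) by exact: scale2E.
by rewrite !omegaE linearZl_LR mulrCA.
Qed.

Lemma omega_sym u v : b u v = b v u.
Proof. by rewrite -[u]repr2K -[v]repr2K !omegaE om_anti twoN. Qed.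

Lemma omega_even u v : exists r, b u v = 2 * r.
Proof. by exists (om (repr2 u) (repr2 v)); rewrite -omegaE !repr2K. Qed.

Lemma omega_nondeg v : (forall u, b u v = 0) -> v = 0.
Proof.
move=> v0; rewrite -[v]repr2K; set w := repr2 v.
have [u wu] : exists u, w = 2 *: u.
  apply: W_ker2; apply: om_symp.2 => u; rewrite linearZl_LR /=.
  by rewrite om_anti twoN -omegaE repr2K v0.
by rewrite -(raddf0 (@pi2 _ W)); apply/pi2P; exists u; rewrite add0r.
Qed.

(** As both factors of [W] are Lagrangian, [om x y] is equal to
    [beta_t x y - beta_t y x]; [omega] is thus the commutator pairing of the
    Heisenberg group, see [heis_comm]. *)
Lemma omega_beta u v : b u v = beta om u v - beta om v u.
Proof.
rewrite -[u]repr2K -[v]repr2K; move: (repr2 u) (repr2 v) => x y.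
rewrite omegaE /beta !(form2E R4) /= -mulrBr; congr (_ * _).
have z1 (a c : L0) : om (a, 0) (c, 0) = 0.
  have : (Defs.orthogonal om [set x | x.2 = 0]) (c, 0) by rewrite lagL0.2.
  exact.
have z2 (a c : M0) : om (0, a) (0, c) = 0.
  have : (Defs.orthogonal om [set x | x.1 = 0]) (0, c) by rewrite lagM0.2.
  exact.
have eD (a : L0) (c : M0) : (a, c) = (a, 0) + (0, c) :> W.
  by apply/eqP; rewrite xpair_eqE /= addr0 add0r !eqxx.
case: x y => a c [a' c']; rewrite /beta_t /= (eD a c) (eD a' c').
by rewrite linearDl /= !linearDr /= z1 z2 add0r addr0 [om (0, c) _]om_anti.
Qed.

Section Character.
Variables (C : numClosedFieldType) (psi : R -> C).
Hypothesis psi2 : exists t, psi (2 * t) != 1.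

(** A nonzero value of [omega] is 2 times a unit, so its multiples fill [2 R],
    on which [psi] is not trivial. *)
Lemma psi_omega u v : b u v != 0 -> exists r, psi (r * b u v) != 1.
Proof.
have [s ->] := omega_even u v => s0; have [t pt] := psi2.
have [[s' ss]|[s' es]] := R_local s; last first.
  by move: s0; rewrite es mulrA mulr22 mul0r eqxx.
by exists (t * s'); rewrite -mulrA [s' * _]mulrCA ss mulr1 mulrC.
Qed.
End Character.

(** ** Group law *)

Implicit Types (g h : H) (z : R) (L M : ELag R4 om).
Local Notation ctr := (center R4 om).

Lemma heisE g h : (g * h)%g = (g.1 + h.1, g.2 + h.2 + beta om g.1 h.1).
Proof. by []. Qed.

Lemma ctrM z h : (ctr z * h)%g = (h.1, z + h.2).
Proof. by rewrite heisE /= beta0v // add0r addr0. Qed.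

Lemma ctr0 : ctr 0 = 1%g. Proof. by []. Qed.

Lemma ctrD z w : ctr (z + w) = (ctr z * ctr w)%g.
Proof. by rewrite ctrM. Qed.

Lemma ctrC z h : (ctr z * h)%g = (h * ctr z)%g.
Proof. by rewrite ctrM heisE /= betav0 // !addr0 addrC. Qed.

Lemma heis_comm g h : (g * h = ctr (b g.1 h.1) * (h * g))%g.
Proof.
rewrite ctrM !heisE /= omega_beta; congr (_, _); first exact: addrC.
by rewrite [h.2 + _]addrC [RHS]addrACA addNr addr0 [RHS]addrC.
Qed.

Lemma ctr_of_fst0 g : g.1 = 0 -> g = ctr g.2.
Proof. by case: g => v z /= ->. Qed.

Lemma heis_same_fst g h : g.1 = h.1 -> g = (ctr (g.2 - h.2) * h)%g.
Proof. by rewrite ctrM subrK => <-; case: g. Qed.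

(** ** Enhanced Lagrangians as subgroups *)

Definition graph L : set H := [set g | exists l : lag L, sect l = g].

Lemma graph_lag L v : lag L v -> exists2 g, graph L g & g.1 = v.
Proof.
move=> Lv; pose l : lag L := exist _ v (mem_set Lv).
by exists (sect l); [exists l | rewrite sectP].
Qed.

Lemma lag_graph L g : graph L g -> lag L g.1.
Proof. by move=> [l <-]; rewrite sectP; apply: set_valP. Qed.

Lemma graph_inj L g h : graph L g -> graph L h -> g.1 = h.1 -> g = h.
Proof.
move=> [l <-] [l' <-]; rewrite !sectP => ll'.
by congr (sect _); apply: val_inj.
Qed.

Lemma lag_submod L : submodule (lag L).
Proof. by case: (lagP L). Qed.

Lemma lag_orth L : Defs.orthogonal b (lag L) = lag L.
Proof. by case: (lagP L). Qed.

Lemma graphM L g h : graph L g -> graph L h -> graph L (g * h)%g.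
Proof.
move=> [l <-] [l' <-].
have Ls : lag L (val l + val l') by apply: submodD (lag_submod L) _ _;
  apply: set_valP.
pose l2 : lag L := exist _ (val l + val l') (mem_set Ls).
by exists l2; apply: sectM.
Qed.

Lemma graph1 L : graph L 1%g.
Proof.
have [g Lg g0] := graph_lag (lag_submod L).1.
have gg : (g * g)%g = g.
  by apply: graph_inj (graphM Lg Lg) Lg _; rewrite heisE /= g0 addr0.
suff -> : 1%g = g by [].
by apply: (mulgI g); rewrite mulg1 gg.
Qed.

Lemma graphV L g : graph L g -> graph L g^-1%g.
Proof.
move=> Lg; have [h Lh hg] := graph_lag (submodN (lag_submod L) (lag_graph Lg)).
suff -> : g^-1%g = h by [].
apply: (mulgI g); rewrite mulgV; apply: graph_inj (graph1 L) (graphM Lg Lh) _.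
by rewrite heisE /= hg subrr.
Qed.

Section Functions.
Variables (Rr : realType) (psi : R -> Rr[i]).
Local Notation C := (Rr[i]).
Hypothesis psi2 : exists t, psi (2 * t) != 1.
Hypothesis psi0 : psi 0 = 1.
Hypothesis psiD : forall x y, psi (x + y) = psi x * psi y.
Local Notation HL := (HL psi).
Implicit Types (f : H -> C).

Lemma psiX4 z : psi z ^+ 4 = 1.
Proof.
have e2 : psi z ^+ 2 = psi (2 * z) by rewrite mulr_natl mulr2n psiD expr2.
have -> : psi z ^+ 4 = psi (2 * (2 * z)).
  by rewrite (exprM _ 2 2) e2 expr2 -psiD [in RHS]mulr_natl mulr2n.
by rewrite mulrA mulr22 mul0r psi0.
Qed.

Lemma HLP L f : HL L f <->
  (forall z h, f (ctr z * h)%g = psi z * f h) /\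
  (forall g h, graph L g -> f (g * h)%g = f h).
Proof.
split=> [Lf | [fz fg] z l h]; last by rewrite -mulgA fz fg //; exists l.
have [l0 l0E] := graph1 L; split=> [z h | g h [l <-]].
  by have := Lf z l0 h; rewrite l0E mulg1.
by have := Lf 0 l h; rewrite ctr0 mul1g psi0 mul1r.
Qed.

Lemma HL_linear L (a : C) f1 f2 : HL L f1 -> HL L f2 -> HL L (a *: f1 + f2).
Proof.
move=> h1 h2 z l h; rewrite -[LHS]/(a * f1 _ + f2 _) h1 h2.
by rewrite -[X in _ = _ * X]/(a * f1 h + f2 h) mulrDr mulrCA.
Qed.

Lemma HLZ L (a : C) f : HL L f -> HL L (a *: f).
Proof.
by move=> h1 z l h; rewrite -[LHS]/(a * f _) h1 mulrCA.
Qed.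

Variables (N : nat) (e : 'I_N -> H) (e_bij : bijective e).

Lemma FML_tsum M f h :
  FML M f h = tsum e (fun g => ind C (graph M) g * f (g * h)%g).
Proof.
rewrite -(tsum_fsbig e_bij) /FML.
have -> : graph M = (fun l : lag M => sect l) @` [set: lag M].
  by apply/seteqP; split=> g [l]; [move=> <-; exists l | move=> _ <-; exists l].
rewrite fsbig_image // => l l' _ _ ll'; apply: val_inj.
by rewrite -!sectP ll'.
Qed.

Lemma left_bij g : bijective (fun h : H => (g * h)%g).
Proof.
by exists (fun h => (g^-1 * h)%g) => h; rewrite mulgA ?mulVg ?mulgV mul1g.
Qed.

Lemma right_bij g : bijective (fun h : H => (h * g)%g).
Proof.
by exists (fun h => (h * g^-1)%g) => h; rewrite -mulgA ?mulVg ?mulgV mulg1.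
Qed.

Lemma ind_graphMr M g h :
  graph M h -> ind C (graph M) (g * h)%g = ind C (graph M) g.
Proof.
move=> Mh; congr (nat_of_bool _)%:R; apply/asbool_equiv_eq; split=> Mg.
  by rewrite -[g](mulgK h); apply: graphM => //; apply: graphV.
exact: graphM.
Qed.

(** [FML] with its sum over the enhanced Lagrangian written as a sum over the
    group, so that changes of variables are translations of the group. *)
Definition avg M f h := tsum e (fun g => ind C (graph M) g * f (g * h)%g).

Definition gsize M := tsum e (ind C (graph M)).

Lemma gsize_neq0 M : gsize M != 0.
Proof. by have := tsum_ind_neq0 e_bij C (graph1 M). Qed.

Definition dot f1 f2 : C := tsum e (fun h => f1 h * (f2 h)^*).

Lemma avg_HL M f : (forall z h, f (ctr z * h)%g = psi z * f h) ->
  HL M (avg M f).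
Proof.
move=> fz; apply/HLP; split=> [z h | g0 h Mg0].
  rewrite /avg -tsumZ; apply: eq_tsum => g.
  by rewrite mulgA -ctrC -mulgA fz mulrCA.
rewrite /avg -[RHS](tsum_bij e_bij _ (right_bij g0)); apply: eq_tsum => g /=.
by rewrite ind_graphMr // mulgA.
Qed.

(** [avg M] is [gsize M] times the orthogonal projection to the functions
    invariant under [M]. *)
Lemma dot_avg M f1 f2 : (forall g h, graph M g -> f2 (g * h)%g = f2 h) ->
  dot (avg M f1) f2 = gsize M * dot f1 f2.
Proof.
move=> f2M; rewrite /dot /avg.
transitivity (tsum e (fun h => tsum e (fun g =>
    ind C (graph M) g * (f1 (g * h)%g * (f2 h)^*)))).
  apply: eq_tsum => h; rewrite mulrC -tsumZ; apply: eq_tsum => g.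
  by rewrite mulrCA [X in _ = _ * X]mulrC.
rewrite exchange_tsum /gsize mulrC -tsumZ; apply: eq_tsum => g.
rewrite tsumZ mulrC; have [Mg|nMg] := pselect (graph M g); last first.
  by rewrite ind_out // !mulr0.
congr (_ * _); rewrite -[RHS](tsum_bij e_bij _ (left_bij g)).
by apply: eq_tsum => h /=; rewrite f2M.
Qed.

Variables (NV : nat) (eV : 'I_NV -> V) (eV_bij : bijective eV).

Lemma graph_sum L (F : V -> C) :
  tsum e (fun g => ind C (graph L) g * F g.1) =
  tsum eV (fun v => ind C (lag L) v * F v).
Proof.
rewrite -(tsum_fsbig e_bij _ (F \o fst)) -(tsum_fsbig eV_bij).
rewrite [RHS](reindex_fsbig fst (graph L)) //.
split; first by move=> g; apply: lag_graph.
  by move=> g h /set_mem Lg /set_mem Lh; exact: (graph_inj Lg Lh).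
by move=> v /graph_lag[g Lg <-]; exists g.
Qed.

Lemma gsize_lag M : gsize M = tsum eV (ind C (lag M)).
Proof.
have ind1 (T : choiceType) (A : set T) : ind C A = (fun x => ind C A x * 1).
  by apply: funext => x; rewrite mulr1.
by rewrite /gsize ind1 (graph_sum M (fun=> 1)) -ind1.
Qed.

Lemma sum_psi_graph L v : tsum e (fun g => ind C (graph L) g * psi (b v g.1)) =
  ind C (lag L) v * gsize L.
Proof.
rewrite (graph_sum L (fun u => psi (b v u))) gsize_lag.
have := sum_character eV_bij omegaDl omegaZl psiD psi0 (psi_omega psi2) v
  (lag_submod L).
rewrite lag_orth => <-.
by apply: eq_tsum => u; rewrite omega_sym.
Qed.

Definition disjoint_lag M L : Prop := forall v, lag M v -> lag L v -> v = 0.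

(** Moving [l] across [m] costs the character [psi (omega m l)] of [l], which
    sums to zero unless [m] is trivial. *)
Lemma avg_avg M L f : disjoint_lag M L -> HL L f ->
  avg L (avg M f) = gsize L *: f.
Proof.
move=> ML0 /HLP[fz fL]; apply: funext => h; rewrite /avg.
transitivity (tsum e (fun m => ind C (graph M) m * f (m * h)%g *
    tsum e (fun l => ind C (graph L) l * psi (b m.1 l.1)))).
  under eq_tsum do rewrite -tsumZ.
  rewrite exchange_tsum; apply: eq_tsum => m; rewrite -tsumZ;
    apply: eq_tsum => l.
  have [Ll|nLl] := pselect (graph L l); last first.
    by rewrite ind_out // !(mul0r, mulr0).
  have -> : f (m * (l * h))%g = psi (b m.1 l.1) * f (m * h)%g.
    by rewrite mulgA (heis_comm m l) -mulgA fz -mulgA fL.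
  rewrite mulrCA -[RHS]mulrA; congr (_ * _).
  by rewrite [RHS]mulrCA; congr (_ * _); exact: mulrC.
under eq_tsum do rewrite sum_psi_graph.
rewrite (tsum1 e_bij (x := 1%g)).
  rewrite !ind_in ?mul1r ?mul1g 1?mulrC //; last exact: graph1.
  exact: (lag_submod L).1.
move=> m /eqP m1; have [Mm|nMm] := pselect (graph M m); last first.
  by rewrite ind_out // !mul0r.
rewrite [ind C (lag L) _]ind_out ?mul0r ?mulr0 // => Lm; apply: m1.
by apply: (graph_inj Mm (graph1 M)); exact: ML0 (lag_graph Mm) Lm.
Qed.

(** Pairing [avg_avg] with [f] gives [dot (avg M f) f = dot f f], as [f] is
    invariant under [L]; the invariance of [avg M f] under [M] does the rest. *)
Lemma avg_norm M L f : disjoint_lag M L -> HL L f ->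
  dot (avg M f) (avg M f) = gsize M * dot f f.
Proof.
move=> ML0 Lf; have [fz fL] := (HLP L f).1 Lf.
have dC f1 f2 : dot f1 f2 = (dot f2 f1)^*.
  by rewrite /dot /tsum rmorph_sum; apply: eq_bigr => i _;
    rewrite rmorphM /= conjCK mulrC.
have e1 : dot (avg M f) f = dot f f.
  apply: (mulfI (gsize_neq0 L)); rewrite -dot_avg // (avg_avg ML0) //.
  by rewrite /dot -tsumZ; apply: eq_tsum => h; rewrite -mulrA.
have [_ avgM] := (HLP M _).1 (@avg_HL M f fz).
rewrite (dot_avg _ avgM).
by rewrite dC e1 -dC.
Qed.

(** ** Integral isometries *)

(** Between two given spaces such operators exist, and they are unique up to a
    fourth root of unity, which the fourth tensor power forgets. They are
    defined on all functions on the group, so as to have a kernel. *)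
Record integral_isometry M L (t : (H -> C) -> (H -> C)) : Prop := {
  isom_linear : linear t;
  isom_HL : forall f, HL L f -> HL M (t f);
  isom_act : forall g f, t (fun h => f (h * g)%g) = (fun h => t f (h * g)%g);
  isom_dyadic : forall f, (forall h, dyadic (f h)) -> forall h, dyadic (t f h);
  isom_dot : forall f, HL L f -> dot (t f) (t f) = dot f f }.

Lemma isom_comp M1 M2 M3 t s : integral_isometry M1 M2 t ->
  integral_isometry M2 M3 s -> integral_isometry M1 M3 (t \o s).
Proof.
move=> [tl tH ta td tn] [sl sH sa sd sn]; split=> /=.
- by move=> a f1 f2; rewrite /= sl tl.
- by move=> f /sH/tH.
- by move=> g f; rewrite sa ta.
- by move=> f /sd/td.
- by move=> f Lf; rewrite tn ?sn //; apply: sH.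
Qed.

Lemma dotZ c f : dot (c *: f) (c *: f) = `|c| ^+ 2 * dot f f.
Proof.
rewrite /dot -tsumZ; apply: eq_tsum => h.
by rewrite rmorphM /= mulrACA normCK.
Qed.

Lemma dot_eq0 f : dot f f = 0 -> f = 0.
Proof.
move=> f0; apply: funext => h; have [e' eK e'K] := e_bij.
have := f0; rewrite /dot /tsum; under eq_bigr do rewrite -normCK.
move=> /eqP; rewrite psumr_eq0 => [|i _]; last by rewrite exprn_ge0.
move=> /allP/(_ (e' h)); rewrite mem_index_enum e'K => /(_ isT) /=.
by rewrite sqrf_eq0 normr_eq0 => /eqP.
Qed.

Lemma avg_isometry k M L : disjoint_lag M L ->
  gsize M = 2 ^+ k ->
  integral_isometry M L (fun f => (1 + 'i) ^- k *: avg M f).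
Proof.
move=> ML0 sM; have avgD (a : C) f1 f2 : avg M (a *: f1 + f2) =
  a *: avg M f1 + avg M f2.
  apply: funext => h; transitivity (a * avg M f1 h + avg M f2 h) => //.
  rewrite /avg -tsumZ /tsum -big_split; apply: eq_bigr => i _ /=.
  by rewrite [X in _ * X = _]/(_ + _) mulrDr mulrCA.
have avgZ a f : avg M (a *: f) = a *: avg M f.
  have avg0 : avg M 0 = 0.
    by apply: funext => h; rewrite /avg /tsum big1 // => i _; rewrite mulr0.
  by rewrite -[a *: f]addr0 avgD avg0 addr0.
split.
- by move=> a f1 f2; rewrite avgD scalerDr !scalerA mulrC.
- by move=> f /HLP[fz _]; apply: HLZ; apply: avg_HL.
- move=> g f; apply: funext => h; congr (_ * _); apply: eq_tsum => g'.
  by rewrite mulgA.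
- move=> f df h; apply: dyadicM; first exact: dyadic_inv1i.
  by apply: dyadic_sum => i; apply: dyadicM => //; apply: dyadic_nat.
- move=> f Lf; rewrite dotZ (avg_norm ML0 Lf) sM mulrA normfV normrX exprVn.
  by rewrite exprAC norm1i mulVf ?mul1r // expf_neq0 ?pnatr_eq0.
Qed.

Definition delta L h : C :=
  xget 0 [set c | exists z g, [/\ graph L g, h = (ctr z * g)%g & c = psi z]].

Lemma delta_graph L z g : graph L g -> delta L (ctr z * g)%g = psi z.
Proof.
move=> Lg; apply: xget_unique => [|c [z' [g' [Lg' zg ->]]]];
  first by exists z, g.
move: zg; rewrite !ctrM => -[/(graph_inj Lg Lg') <-].
by move=> /addIr ->.
Qed.

Lemma delta_out L h : ~ lag L h.1 -> delta L h = 0.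
Proof.
move=> nLh; apply: xgetPN => c [z [g [Lg hE _]]]; apply: nLh.
by rewrite hE ctrM; exact: (lag_graph Lg).
Qed.

Lemma graph_cases L h :
  (exists z g, graph L g /\ h = (ctr z * g)%g) \/ ~ lag L h.1.
Proof.
have [Lh|] := pselect (lag L h.1); last by right.
left; have [g Lg gh] := graph_lag Lh; exists (h.2 - g.2), g; split=> //.
exact: heis_same_fst.
Qed.

Lemma delta_HL L : HL L (delta L).
Proof.
apply/HLP; split=> [z h | g h Lg].
  have [[w [g [Lg ->]]]|nLh] := graph_cases L h.
    by rewrite mulgA -ctrD !delta_graph // psiD.
  by rewrite !delta_out ?mulr0 // ctrM.
have [[w [g' [Lg' ->]]]|nLh] := graph_cases L h.
  by rewrite mulgA -ctrC -mulgA !delta_graph //; apply: graphM.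
rewrite !delta_out // heisE => Lgh; apply: nLh.
have -> : h.1 = (g.1 + h.1) - g.1 by rewrite addrC addKr.
exact: submodB (lag_submod L) Lgh (lag_graph Lg).
Qed.

Lemma delta1 L : delta L 1%g = 1.
Proof. by rewrite -psi0 -(delta_graph 0 (graph1 L)) mulg1. Qed.

Lemma delta_graphr L h s : graph L s -> delta L (h * s)%g = delta L h.
Proof.
move=> Ls; have [[w [g' [Lg' ->]]]|nLh] := graph_cases L h.
  by rewrite -mulgA !delta_graph //; apply: graphM.
rewrite !delta_out // heisE => Lgh; apply: nLh.
rewrite -[h.1](addrK s.1).
exact: submodB (lag_submod L) Lgh (lag_graph Ls).
Qed.

Lemma delta_dyadic L h : dyadic (delta L h).
Proof.
have [[w [g' [Lg' ->]]]|nLh] := graph_cases L h.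
  by rewrite delta_graph //; apply: dyadic_root4; apply: psiX4.
by rewrite delta_out //; apply: (dyadic_nat _ 0).
Qed.

(** An intertwiner maps [delta L] to a function that is invariant under right
    translation by [L], hence supported on [Z * L]. *)
Lemma isom_delta L t : integral_isometry L L t ->
  t (delta L) = t (delta L) 1%g *: delta L.
Proof.
move=> tI; apply: funext => h.
have [tz tg] := (HLP L _).1 (isom_HL tI (@delta_HL L)).
have tr s : graph L s -> t (delta L) h = t (delta L) (h * s)%g.
  move=> Ls; rewrite -[RHS](congr1 (fun f => f h) (isom_act tI s (delta L))).
  by congr (t _ h); apply: funext => h'; rewrite delta_graphr.
have [[w [g [Lg ->]]]|nLh] := graph_cases L h.
  rewrite -[RHS]/(t (delta L) 1%g * delta L _) delta_graph // mulrC.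
  by rewrite -(tg g 1%g) // mulg1 tz.
rewrite -[RHS]/(t (delta L) 1%g * delta L _) delta_out // mulr0.
have [l [Ll lv]] : exists l, lag L l /\ b h.1 l != 0.
  apply: contrapT => hh; apply: nLh; rewrite -lag_orth => l Ll.
  by apply: contrapT => /eqP lv; apply: hh; exists l; rewrite omega_sym.
have [r /eqP r1] := psi_omega psi2 lv.
have [s Ls sE] := graph_lag (submodZ r (lag_submod L) Ll).
have := tr s Ls; rewrite heis_comm tz tg // sE omega_sym omegaZl omega_sym.
move=> e1; have /eqP : (1 - psi (r * b h.1 l)) * t (delta L) h = 0.
  by rewrite mulrBl mul1r -e1 subrr.
by rewrite mulf_eq0 subr_eq0 eq_sym => /orP[/eqP//|/eqP].
Qed.

Lemma isom_sum M L t (I : finType) (c : I -> C) (F : I -> H -> C) :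
  integral_isometry M L t ->
  t (\sum_i c i *: F i) = \sum_i c i *: t (F i).
Proof.
move=> tI; have t0 := linear_zero (isom_linear tI).
elim/big_rec2: _ => // i f1 f2 _ <-; exact: (isom_linear tI).
Qed.

(** The right translates of [delta L] span [HL L]: summed against [f] they
    average [f] over [Z * L], along which it is equivariant. *)
Lemma HL_delta_sum L f : HL L f ->
  tsum e (ind C [set h : H | lag L h.1]) *: f =
  \sum_i f (e i) *: (fun h => delta L (h * (e i)^-1)%g).
Proof.
move=> /HLP[fz fL]; apply: funext => h; rewrite fct_sumE /=.
rewrite -[RHS]/(tsum e (fun g => f g * delta L (h * g^-1)%g)).
have bij : bijective (fun u : H => (u^-1 * h)%g).
  exists (fun g => h * g^-1)%g => u; rewrite invgM invgK.
    by rewrite mulgA mulgV mul1g.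
  by rewrite -mulgA mulVg mulg1.
rewrite -[RHS](tsum_bij e_bij _ bij) -[LHS]/(_ * f h) mulrC -tsumZ;
  apply: eq_tsum => u /=.
rewrite invgM invgK mulgA mulgV mul1g.
have [[w [g [Lg ->]]]|nLh] := graph_cases L u; last first.
  by rewrite delta_out // ind_out // !mulr0.
have lagE : lag L (ctr w * g)%g.1 by rewrite ctrM; exact: (lag_graph Lg).
rewrite delta_graph // ind_in ?mulr1; last exact: lagE.
have -> : f h = psi w * f ((ctr w * g)^-1 * h)%g.
  by rewrite -fz -[RHS](fL g) // mulgA -ctrC mulVKg.
by rewrite mulrC.
Qed.

(** Schur's lemma, with the scalar pinned down: it is the value at 1 of the
    image of [delta L], an element of Z[i, 1/2] of absolute value 1. *)
Lemma isom_scalar L t : integral_isometry L L t ->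
  exists2 c, c ^+ 4 = 1 & forall f, HL L f -> t f = c *: f.
Proof.
move=> tI; set c := t (delta L) 1%g; have td := isom_delta tI;
  rewrite -/c in td.
exists c.
  apply: dyadic_norm1; first by apply: (isom_dyadic tI) => h;
    apply: delta_dyadic.
  have d0 : dot (delta L) (delta L) != 0.
    apply/eqP => /dot_eq0 /(congr1 (fun f => f 1%g)).
    by rewrite delta1 => /eqP; rewrite oner_eq0.
  have := isom_dot tI (@delta_HL L); rewrite td dotZ -[RHS]mul1r =>
    /(mulIf d0)/eqP.
  by rewrite sqrp_eq1 ?normr_ge0 // => /eqP.
move=> f Lf; have K0 : tsum e (ind C [set h : H | lag L h.1]) != 0.
  by apply: (tsum_ind_neq0 e_bij C (x := 1%g)); apply: (lag_submod L).1.
apply: (scalerI K0); rewrite -[LHS]addr0.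
have t0 := linear_zero (isom_linear tI).
rewrite -{1}t0 -(isom_linear tI) addr0 HL_delta_sum // (isom_sum _ _ tI).
rewrite [RHS]scalerA [_ * c]mulrC -[RHS]scalerA HL_delta_sum // scaler_sumr;
  apply: eq_bigr => i _.
by rewrite (isom_act tI) td scalerA mulrC -scalerA.
Qed.

(** Composed with [s], both operators become scalars by [isom_scalar]. *)
Lemma isom_unique M L s t t' : integral_isometry L M s ->
  integral_isometry M L t -> integral_isometry M L t' ->
  exists2 c, c ^+ 4 = 1 & forall f, HL L f -> t' f = c *: t f.
Proof.
move=> sI tI t'I.
have [a a4 aE] := isom_scalar (isom_comp sI tI).
have [a' a'4 a'E] := isom_scalar (isom_comp sI t'I).
have a0 : a != 0 by apply: contra_eq_neq a4 => ->;
  rewrite expr0n eq_sym oner_eq0.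
exists (a' / a); first by rewrite expr_div_n a4 a'4 divr1.
move=> f Lf; apply/eqP; rewrite -subr_eq0; apply/eqP; apply: dot_eq0.
have subE : t' f - (a' / a) *: t f = - (a' / a) *: t f + t' f.
  by rewrite scaleNr addrC.
have HLu : HL M (t' f - (a' / a) *: t f).
  by rewrite subE; apply: HL_linear; [apply: (isom_HL tI)|apply: (isom_HL t'I)].
rewrite -(isom_dot sI HLu) subE (isom_linear sI).
have -> : s (t f) = a *: f by exact: aE.
have -> : s (t' f) = a' *: f by exact: a'E.
rewrite scalerA mulNr divfK // scaleNr addNr.
by rewrite /dot /tsum big1 // => i _; rewrite mul0r.
Qed.

(** ** Common transversals *)

Lemma fset_set_lag M : (#|` fset_set (lag M)|)%:R = tsum eV (ind C (lag M)).
Proof.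
transitivity (\sum_(v \in lag M) (1 : C)); last first.
  by rewrite (tsum_fsbig eV_bij); apply: eq_tsum => v; rewrite mulr1.
rewrite fsbig_finite; last first.
  have [e' eK e'K] := eV_bij.
  apply: (sub_finite_set (B := eV @` [set: 'I_NV])).
    by move=> v _; exists (e' v).
  by apply: finite_image; apply: finite_finset.
by rewrite big_const_seq count_predT iter_addr_0.
Qed.

(** The square of the number of elements of a Lagrangian is the number of
    elements of [V], by [lagrangian_card]. *)
Lemma gsize_exp k M : NV = (2 ^ k * 2 ^ k)%N -> gsize M = 2 ^+ k.
Proof.
move=> NVE; rewrite gsize_lag.
have := lagrangian_card eV_bij omegaDl omegaZl omega_sym omega_nondeg psiD psi0
  (psi_omega psi2) (lagP M).
have -> : NV%:R = (2 ^+ k) ^+ 2 :> C by rewrite NVE natrM natrX expr2.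
move=> /eqP.
by rewrite eqrXn2 // ?exprn_ge0 ?tsum_ind ?ler0n // => /eqP.
Qed.

(** The graph of an enhanced isotropic subspace. *)
Definition enhanced (G : set H) : Prop :=
  [/\ G 1%g, forall g h, G g -> G h -> G (g * h)%g,
      forall z, G (ctr z) -> z = 0
    & forall r g, G g -> exists2 h, G h & h.1 = r *: g.1].

Definition proj (G : set H) : set V := [set v | exists2 g, G g & g.1 = v].

Section Enhanced.
Variables (G : set H) (enhG : enhanced G).

Lemma enhanced_fst0 g : G g -> g.1 = 0 -> g = 1%g.
Proof.
have [_ _ Gz _] := enhG => Gg /ctr_of_fst0 gE.
by rewrite gE in Gg *; rewrite (Gz _ Gg).
Qed.

Lemma enhancedV g : G g -> G g^-1%g.
Proof.
have [G1 GM Gz GZ] := enhG => Gg; have [h Gh hE] := GZ (-1) g Gg.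
suff -> : g^-1%g = h by [].
apply: (mulgI g); rewrite mulgV; apply/esym/enhanced_fst0; first exact: GM.
by rewrite heisE /= hE scaleN1r subrr.
Qed.

Lemma enhanced_inj g h : G g -> G h -> g.1 = h.1 -> g = h.
Proof.
have [G1 GM Gz GZ] := enhG => Gg Gh gh.
have : (g * h^-1)%g = 1%g.
  apply: enhanced_fst0; first by apply: GM => //; apply: enhancedV.
  by rewrite heisE /= gh subrr.
by move=> /(congr1 (fun x => x * h)%g); rewrite -mulgA mulVg mulg1 mul1g.
Qed.

Lemma enhanced_submod : submodule (proj G).
Proof.
have [G1 GM Gz GZ] := enhG.
split; first by exists 1%g.
move=> r _ _ [g Gg <-] [h Gh <-]; have [g' Gg' g'E] := GZ r g Gg.
by exists (g' * h)%g; [exact: GM|rewrite heisE /= g'E].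
Qed.

Lemma enhanced_isotropic : proj G `<=` Defs.orthogonal b (proj G).
Proof.
have [G1 GM Gz GZ] := enhG.
move=> _ [g Gg <-] _ [h Gh <-]; apply: Gz.
have <- : (h * g * (g * h)^-1)%g = ctr (b h.1 g.1).
  by rewrite (heis_comm h g) mulgK.
by apply: (GM); [exact: GM|apply/enhancedV/GM].
Qed.

Lemma enhanced_ELag : Defs.orthogonal b (proj G) `<=` proj G ->
  exists M : ELag R4 om, lag M = proj G.
Proof.
have [G1 GM Gz GZ] := enhG => oG.
have lG : lagrangian b (proj G).
  split; first exact: enhanced_submod.
  by apply/seteqP; split; [exact: oG|exact: enhanced_isotropic].
have /boolp.choice[s sP] (l : proj G) : exists g, G g /\ g.1 = val l.
  by have [g Gg gl] := set_valP l; exists g.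
have sM (l1 l2 l3 : proj G) :
    val l3 = val l1 + val l2 -> s l3 = (s l1 * s l2)%g.
  move=> l3E; apply: enhanced_inj; first exact: (sP _).1.
    by apply: (GM); apply: (sP _).1.
  by rewrite heisE /= !(sP _).2.
by exists (MkELag lG (fun l => (sP l).2) sM).
Qed.

(** A lift [x] of [v] to the free module makes [a v |-> (a v, a ^ 2 q)], with
    [q] the value of the lifted form at [x], a homomorphism; it is well defined
    since [(a + 2 c) ^ 2 = a ^ 2] modulo 4. *)
Lemma enhanced_line (v : V) : exists2 k : R -> H,
  (forall a, (k a).1 = a *: v) &
  (forall a c, k (a + c) = (k a * k c)%g) /\ (forall c, k (2 * c) = 1%g).
Proof.
pose x := repr2 v; pose q := beta_t om x x.
exists (fun a => (a *: v, a ^+ 2 * q)) => //; split=> [a c|c].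
  rewrite heisE /= scalerDl; congr (_, _).
  have vE t : t *: v = pi2 (t *: x) by rewrite -[v]repr2K; exact: scale2E.
  rewrite /beta !vE (form2E R4) linearZl_LR linearZr_LR /= -/q.
  rewrite sqrrD !mulrDl [LHS]addrAC; congr (_ + _).
  by rewrite !mul1r !mulrA.
congr (_, _); last by rewrite exprMn expr2 mulr22 !mul0r.
exact: mod2_scale2.
Qed.

(** The subgroup generated by [G] and a line over [v]: they commute because [v]
    is orthogonal to [G], and it meets the center trivially because [v] is
    independent of [G]. *)
Lemma enhanced_extend v : Defs.orthogonal b (proj G) v -> ~ proj G v ->
  exists G', [/\ enhanced G', G `<=` G', exists2 g, G' g & g.1 = v
    & forall g, G' g -> exists2 n, proj G n & exists a, g.1 = n + a *: v].
Proof.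
have [G1 GM Gz GZ] := enhG => ov nv.
have [k kE [kD k2]] := enhanced_line v.
have k0 : k 0 = 1%g by rewrite -(mulr0 2) k2.
exists [set g | exists2 n, G n & exists a, g = (n * k a)%g]; split; last first.
- move=> _ [n Gn [a ->]]; exists n.1; first by exists n.
  by exists a; rewrite heisE /= kE.
- exists (k 1); last by rewrite kE scale1r.
  by exists 1%g => //; exists 1; rewrite mul1g.
- by move=> g Gg; exists g => //; exists 0; rewrite k0 mulg1.
split.
- by exists 1%g => //; exists 0; rewrite k0 mulg1.
- move=> _ _ [n Gn [a ->]] [n' Gn' [a' ->]].
  exists (n * n')%g; first exact: GM.
  exists (a + a'); rewrite kD -!mulgA; congr (_ * _)%g; rewrite !mulgA;
    congr (_ * _)%g.
  rewrite heis_comm kE omegaZl omega_sym ov ?mulr0 ?ctr0 ?mul1g //.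
  by exists n'.
- move=> z [n Gn [a zE]]; have := congr1 fst zE; rewrite heisE /= kE => e0.
  have [[s sa]|[s aE]] := R_local a; last first.
    by apply: Gz; rewrite zE aE k2 mulg1.
  case: nv; have -> : v = (- s) *: n.1.
    have -> : n.1 = - (a *: v) by apply/eqP; rewrite -addr_eq0 -e0.
    by rewrite scalerN scaleNr opprK scalerA sa scale1r.
  by have [h Gh hE] := GZ (- s) n Gn; exists h.
- move=> r _ [n Gn [a ->]]; have [h Gh hE] := GZ r n Gn.
  exists (h * k (r * a)%R)%g; first by exists h => //; exists (r * a).
  by rewrite !heisE /= !kE hE scalerDr scalerA.
Qed.

End Enhanced.

Lemma transversal_disjoint M L : Defs.transversal M L -> disjoint_lag M L.
Proof.
exact: (lagrangian_disjoint omegaDl omega_nondeg (lagP M) (lagP L)).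
Qed.

Lemma disjoint_transversal M L : disjoint_lag M L -> Defs.transversal M L.
Proof.
apply: (sumset_full eV_bij omegaDl omegaZl omega_sym omega_nondeg psiD psi0
  (psi_omega psi2) (lag_submod M) _ (lagP L)).
by rewrite lag_orth.
Qed.

Lemma disjoint_lagC M L : disjoint_lag M L -> disjoint_lag L M.
Proof. by move=> ML v Lv Mv; apply: ML. Qed.

(** A maximal enhanced isotropic subspace that meets neither [M] nor [L] is
    Lagrangian, as it can otherwise be enlarged by a line. *)
Lemma common_disjoint M L : exists P, disjoint_lag P M /\ disjoint_lag P L.
Proof.
pose misses (G : set H) (S : ELag R4 om) :=
  forall v, proj G v -> lag S v -> v = 0.
suff ext k G : enhanced G -> misses G M -> misses G L ->
    (N - #|[pred i | `[< G (e i) >]]| < k)%N ->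
    exists P, disjoint_lag P M /\ disjoint_lag P L.
  apply: (ext N.+1 [set 1%g]); last by rewrite ltnS leq_subr.
  - split=> //= [g h -> ->|z /(congr1 snd)|r g ->] //; first by rewrite mulg1.
    by exists 1%g => //; rewrite scaler0.
  - by move=> _ [g -> <-].
  - by move=> _ [g -> <-].
elim: k => // k IHk in G * => enhG GM GL ltk.
have [oG|noG] := pselect (Defs.orthogonal b (proj G) `<=` proj G).
  by have [P PE] := enhanced_ELag enhG oG; exists P; rewrite /disjoint_lag PE.
have [v [ov nvM nvL]] := avoid_lagrangians eV_bij omegaDl omegaZl omega_sym
  omega_nondeg psiD psi0 (psi_omega psi2) (enhanced_submod enhG)
  (enhanced_isotropic enhG) noG (lagP M) (lagP L).
have nv : ~ proj G v.
  by move=> Gv; apply: nvM; exists v => //; exists 0; rewrite ?addr0 //;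
    exact: (lag_submod M).1.
have [G' [enhG' GG' [g0 Gg0 g0v] G'E]] := enhanced_extend enhG ov nv.
have step S : misses G S -> ~ sumset (proj G) (lag S) v -> misses G' S.
  move=> GS nS _ [g /G'E[n Gn [a gE]] <-] Sg.
  have [[s sa]|[s aE]] := R_local a; last first.
    by apply: GS => //; rewrite gE aE mod2_scale2 addr0.
  case: nS; exists (- s *: n); first exact: submodZ (enhanced_submod enhG) Gn.
  exists (s *: g.1); first exact: submodZ (lag_submod S) Sg.
  by rewrite gE scalerDr scalerA sa scale1r scaleNr addKr.
apply: (IHk G') => //; [exact: step|exact: step|].
have ltG : (#|[pred i | `[< G (e i) >]]| < #|[pred i | `[< G' (e i) >]]|)%N.
  apply: fintype.proper_card; apply/fintype.properP; split.
    by apply/fintype.subsetP => i; rewrite !unfold_in => /asboolP/GG' ?;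
      apply/asboolP.
  have [e' eK e'K] := e_bij; exists (e' g0); rewrite unfold_in /= e'K;
    first exact/asboolP.
  by apply/asboolP => Gg; apply: nv; exists g0.
have := max_card [pred i | `[< G' (e i) >]]; rewrite card_ord => maxG.
exact: leq_trans (ltn_sub2l (leq_trans ltG maxG) ltG) ltk.
Qed.

Lemma isometry_exists k M L : NV = (2 ^ k * 2 ^ k)%N ->
  exists t, integral_isometry M L t.
Proof.
move=> NVE; have [P [PM PL]] := common_disjoint M L.
have MP := disjoint_lagC PM.
exists ((fun f => (1 + 'i) ^- k *: avg M f) \o
  (fun f => (1 + 'i) ^- k *: avg P f)).
by apply: (isom_comp (M2 := P)); apply: avg_isometry => //; apply: gsize_exp.
Qed.

(** ** Tensor powers *)

Local Notation bun := (Hbundle R4 om psi 4).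
Local Notation Fib := (fiber bun).

Definition dirac (g : H) : H -> C := fun h => (h == g)%:R.

(** The values of [t] on the functions [dirac g] are its matrix entries; an
    operator on all functions of four variables is obtained by multiplying
    them. *)
Definition tens (t : (H -> C) -> (H -> C)) (phi : {ffun 'I_4 -> H} -> C) :
    {ffun 'I_4 -> H} -> C :=
  fun x => \sum_(j : {ffun 'I_4 -> 'I_N})
    phi [ffun i => e (j i)] * \prod_i t (dirac (e (j i))) (x i).

Lemma tens_linear t a phi chi :
  tens t (a *: phi + chi) = a *: tens t phi + tens t chi.
Proof.
apply: funext => x; transitivity (a * tens t phi x + tens t chi x) => //.
rewrite /tens mulr_sumr -big_split; apply: eq_bigr => j _ /=.
by rewrite [X in X * _ = _]/(_ + _) mulrDl -mulrA.
Qed.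

Lemma tens_pure M L t (f : 'I_4 -> H -> C) : integral_isometry M L t ->
  tens t (pure_tensor f) = pure_tensor (fun i => t (f i)).
Proof.
move=> tI; have tf f1 h : t f1 h = \sum_j f1 (e j) * t (dirac (e j)) h.
  have {1}-> : f1 = \sum_j f1 (e j) *: dirac (e j).
    apply: funext => h'; rewrite fct_sumE /=.
    rewrite -[RHS]/(tsum e (fun g => f1 g * dirac g h')).
    rewrite (tsum1 e_bij (x := h')).
      by rewrite /dirac eqxx mulr1.
    by move=> g gh; rewrite /dirac eq_sym (negPf gh) mulr0.
  by rewrite (isom_sum _ _ tI) fct_sumE.
apply: funext => x; rewrite /tens /pure_tensor.
under [RHS]eq_bigr do rewrite tf.
rewrite bigA_distr_bigA; apply: eq_bigr => j _; rewrite -big_split.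
by apply: eq_bigr => i _; rewrite ffunE.
Qed.

Lemma tens_tpow M L t phi : integral_isometry M L t ->
  phi \in tensor_power (HL L) -> tens t phi \in @tensor_power Rr H 4 (HL M).
Proof.
move=> tI /asboolP[s [Hs ->]]; elim: s Hs => [|u s IHs] Hs.
  rewrite big_nil; have -> : tens t 0 = 0; last exact: rpred0.
  by apply: funext => x; rewrite /tens big1 // => j _; rewrite mul0r.
rewrite big_cons tens_linear rpredD //; last first.
  by apply: IHs => v vs; apply: Hs; rewrite inE vs orbT.
rewrite rpredZ // (tens_pure _ tI); apply/asboolP.
exists [:: (1, fun i => t (u.2 i))]; split; last by rewrite big_seq1 scale1r.
by move=> v; rewrite inE => /eqP -> i; apply: (isom_HL tI); apply: Hs;
  rewrite inE eqxx.
Qed.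

Lemma pure_tpow L (f : 'I_4 -> H -> C) : (forall i, HL L (f i)) ->
  pure_tensor f \in tensor_power (HL L).
Proof.
move=> Lf; apply/asboolP; exists [:: (1, f)]; split;
  last by rewrite big_seq1 scale1r.
by move=> v; rewrite inE => /eqP ->.
Qed.

(** The pure tensors span the fiber. *)
Lemma fiber_ext L (U : lmodType C) (p q : Fib L -> U) : linear p -> linear q ->
  (forall (f : 'I_4 -> H -> C) (x : Fib L),
    (forall i, HL L (f i)) -> val x = pure_tensor f -> p x = q x) ->
  forall x, p x = q x.
Proof.
move=> pl ql pq x; have /asboolP[s [Hs xs]] := valP x.
have [p0 q0] := (linear_zero pl, linear_zero ql).
elim: s x Hs xs => [|u s IHs] x Hs xs.
  by have -> : x = 0; [apply: val_inj; rewrite xs big_nil | rewrite p0 q0].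
have Hu i : HL L (u.2 i) by apply: Hs; rewrite inE eqxx.
pose y : Fib L := Sub (pure_tensor u.2) (pure_tpow Hu).
have -> : x = u.1 *: y + (x - u.1 *: y) by rewrite addrC subrK.
rewrite pl ql (pq u.2 y Hu erefl); congr (_ + _); apply: IHs.
  by move=> v vs; apply: Hs; rewrite inE vs orbT.
have -> : val (x - u.1 *: y) = val x - u.1 *: pure_tensor u.2 by [].
by rewrite xs big_cons addrC addKr.
Qed.

Definition tens_map M L t (tI : integral_isometry M L t) (x : Fib L) : Fib M :=
  Sub (tens t (val x)) (tens_tpow tI (valP x)).

Lemma tens_map_linear M L t (tI : integral_isometry M L t) :
  linear (tens_map tI).
Proof. by move=> a x y; apply: val_inj; apply: tens_linear. Qed.

Lemma tens_map_pure M L t (tI : integral_isometry M L t)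
    (f : 'I_4 -> H -> C) (x : Fib L) :
  val x = pure_tensor f -> val (tens_map tI x) = pure_tensor (fun i => t (f i)).
Proof. by move=> /= ->; apply: tens_pure tI. Qed.

Lemma pure_tensorZ (c : C) (f : 'I_4 -> H -> C) :
  pure_tensor (fun i => c *: f i) = c ^+ 4 *: pure_tensor f.
Proof.
apply: funext => x; rewrite -[RHS]/(_ * \prod_i f i (x i)) /pure_tensor.
by rewrite big_split prodr_const card_ord.
Qed.

Lemma tens_map_unique M L s t t' (sI : integral_isometry L M s)
    (tI : integral_isometry M L t) (t'I : integral_isometry M L t') x :
  tens_map tI x = tens_map t'I x.
Proof.
move: x; apply: fiber_ext; [exact: tens_map_linear|exact: tens_map_linear|].
move=> f x Lf xf; apply: val_inj; rewrite !(tens_map_pure _ xf).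
have [c c4 cE] := isom_unique sI t'I tI.
rewrite (_ : (fun i => t (f i)) = (fun i => c *: t' (f i))); last first.
  by apply: funext => i; apply: cE.
by rewrite pure_tensorZ c4 scale1r.
Qed.

Lemma tens_map_comp M1 M2 M3 t s (tI : integral_isometry M1 M2 t)
    (sI : integral_isometry M2 M3 s) x :
  tens_map (isom_comp tI sI) x = tens_map tI (tens_map sI x).
Proof.
move: x; apply: fiber_ext; first exact: tens_map_linear.
  by move=> a x y; rewrite !tens_map_linear.
move=> f x Lf xf; apply: val_inj.
by rewrite !(tens_map_pure _ xf) (tens_map_pure tI (tens_map_pure sI xf)).
Qed.

Lemma isom_id L : integral_isometry L L id.
Proof. by []. Qed.

Lemma tens_map_id L x : tens_map (isom_id L) x = x.
Proof.
move: x; apply: fiber_ext => [||f x Lf xf] //; first exact: tens_map_linear.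
by apply: val_inj; rewrite (tens_map_pure _ xf).
Qed.

Lemma tens_map_act M L t (tI : integral_isometry M L t) (g : gpow 4 H)
    (x : Fib L) :
  tens_map tI (act g x) = act g (tens_map tI x).
Proof.
move: x; apply: fiber_ext.
- by move=> a x y; rewrite act_linear tens_map_linear.
- by move=> a x y; rewrite tens_map_linear act_linear.
move=> f x Lf xf; apply: val_inj.
have transE (f1 : 'I_4 -> H -> C) : translate g (pure_tensor f1) =
  pure_tensor (fun i h => f1 i (h * g i)%g).
  by apply: funext => h; apply: eq_bigr => i _; rewrite ffunE.
have -> : val (act g (tens_map tI x)) = translate g (val (tens_map tI x)) by [].
rewrite (tens_map_pure _ xf) transE.
have gxf : val (act g x) = pure_tensor (fun i h => f i (h * g i)%g).
  by rewrite -transE -xf.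
rewrite (tens_map_pure _ gxf).
by congr pure_tensor; apply: funext => i; apply: (isom_act tI).
Qed.

(** ** The trivialization *)

Section Trivialization.
Variables (d n : nat) (NVE : NV = (2 ^ (d * n) * 2 ^ (d * n))%N).

Lemma trivialization_exists : exists T : forall M L, Fib L -> Fib M,
  trivialization T /\ extends_T d n T.
Proof.
have /boolp.choice[t tI] (p : ELag R4 om * ELag R4 om) :
    exists t, integral_isometry p.1 p.2 t by exact: isometry_exists NVE.
pose T M L : Fib L -> Fib M := tens_map (tI (M, L)).
have TE M L t' (t'I : integral_isometry M L t') x : T M L x = tens_map t'I x.
  exact: (tens_map_unique (tI (L, M))).
have TC M1 M2 M3 x : T M1 M2 (T M2 M3 x) = T M1 M3 x.
  by rewrite [RHS](TE _ _ _ (isom_comp (tI (M1, M2)) (tI (M2, M3))))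
    tens_map_comp.
have T1 L x : T L L x = x by rewrite (TE _ _ _ (isom_id L)) tens_map_id.
exists T; split; first split=> //.
- by move=> M L; apply: tens_map_linear.
- by move=> M L; exists (T L M) => x; rewrite TC T1.
- by move=> M L g x; apply: tens_map_act.
move=> M L /transversal_disjoint ML f x Lf xf.
have kI := avg_isometry ML (gsize_exp M NVE).
rewrite (TE _ _ _ kI) (tens_map_pure _ xf) pure_tensorZ.
have -> : (fun i => FML M (f i)) = (fun i => avg M (f i)).
  by apply: funext => i; apply: funext => h; apply: FML_tsum.
congr (_ *: _); rewrite fset_set_lag -gsize_lag (gsize_exp M NVE).
rewrite exprVn exprAC onei_exp4.
have -> : - 4 = -1 * 2 ^+ 2 :> C by rewrite mulN1r -natrX.
by rewrite exprMn invfM -[(-1) ^- _]exprVn invrN1 [(2 ^+ 2) ^+ _]exprAC.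
Qed.

Lemma trivialization_unique (T T' : forall M L, Fib L -> Fib M) :
  trivialization T -> extends_T d n T ->
  trivialization T' -> extends_T d n T' -> T = T'.
Proof.
move=> [Tl Tb Ta TC] Te [T'l T'b T'a T'C] T'e.
have ext M L : disjoint_lag M L -> T M L =1 T' M L.
  move=> /disjoint_transversal ML; apply: fiber_ext; [exact: Tl|exact: T'l|].
  move=> f x Lf xf; apply: val_inj.
  by rewrite (Te _ _ ML _ _ Lf xf) (T'e _ _ ML _ _ Lf xf).
apply: functional_extensionality_dep => M.
apply: functional_extensionality_dep => L; apply: funext => x.
have [P [PM PL]] := common_disjoint M L.
by rewrite -(TC M P L) -(T'C M P L) !ext //; apply: disjoint_lagC.
Qed.

End Trivialization.
End Functions.

End Heisenberg.

Theorem theorem4p3 (Rr : realType) (K : fieldExtType Q2adic) (d n : nat)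
    (L0 M0 : vectType (RK K)) (om : {biscalar (L0 * M0)%type})
    (hd : \dim {:K} = d) (hK : unramified K)
    (hrank : dim (L0 * M0)%type = (2 * n)%N)
    (hom : symplectic om)
    (hL0 : lagrangian om [set x | x.2 = 0])
    (hM0 : lagrangian om [set x | x.1 = 0]) :
  exists! T : (forall M L : ELag (RK4 K) om,
      fiber (Hbundle (RK4 K) om (@psiK K Rr) 4) L ->
      fiber (Hbundle (RK4 K) om (@psiK K Rr) 4) M),
    trivialization T /\ extends_T d n T.
Proof.
have [x [gen_x indep_x]] := RK_basis hK.
have [eV eV_bij] := mod2_enum (L0 * M0)%type gen_x indep_x.
have NVE : (2 ^ (\dim {:K} * dim (L0 * M0)%type) = 2 ^ (d * n) * 2 ^ (d * n))%N.
  by rewrite hd hrank -expnD addnn -mul2n mulnCA.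
have [NR [eR eR_bij]] := RK_finite hK.
have [N [e e_bij]] : exists N (e : 'I_N -> Heis (RK4 K) om), bijective e.
  exact: enum_prod eV_bij eR_bij.
have W2 (v : (L0 * M0)%type) := vect_ker2 (v := v) (@RK_mul2_eq0 K).
have psi2 := psiK_nontrivial Rr hK.
have [T [Ttriv Text]] := trivialization_exists hom hL0 hM0 (RK_local hK) W2 psi2
  (psiK_0 Rr hK) (psiK_D Rr hK) e_bij eV_bij NVE.
exists T; split=> // T' [T'triv T'ext].
exact: (trivialization_unique hom hL0 hM0 (RK_local hK) W2 psi2
  (psiK_0 Rr hK) (psiK_D Rr hK) e_bij eV_bij Ttriv Text).
Qed.
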